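(* Let $\mathbb G$ be a group of Heisenberg type with homogeneous dimension $Q=m+2k$, and let $\rho\in C_0(\mathbb G)$ with $\rho\ge 0$. For a real number $\alpha<Q$, $\alpha\neq 0$, set $$F_\alpha(g)=\int_{\mathbb G}\frac{\rho(g')}{N(g^{-1}g')^{\alpha}}\,dg'$$ (this is the Riesz potential $R_{Q-\alpha}(\rho)$), and set $$F_0(g)=R_Q(\rho)(g)=\int_{\mathbb G}\rho(g')\log N(g^{-1}g')\,dg'.$$ Then: 1) If $2<p<Q$ and $0<\alpha\le \frac{Q-p}{p-1}$, then $F_\alpha$ is $p$-superharmonic, i.e. $\mathcal L_pF_\alpha\le 0$ on $\mathbb G$. 2) If $p>Q$ and $-\alpha\ge\frac{p-Q}{p-1}$, then $F_\alpha$ is $p$-subharmonic, i.e. $\mathcal L_pF_\alpha\ge 0$ on $\mathbb G$. In the case $p=\infty$ the same conclusion holds, namely $\mathcal L_\infty F_\alpha\ge 0$ on $\mathbb G$, whenever $-\alpha\ge 1$. 3) If $p=Q$, then $F_0=R_Q(\rho)$ is $Q$-subharmonic, i.e. $\mathcal L_QF_0\ge 0$ on $\mathbb G$.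
   Context: A Carnot group of step two is a connected, simply connected Lie group $\mathbb G$ whose Lie algebra is $\mathfrak g=V_1\oplus V_2$ with $[V_1,V_1]=V_2$ and $[V_1,V_2]=\{0\}$. The Lie algebra $\mathfrak g$ carries an inner product $\langle\cdot,\cdot\rangle$ for which $V_1\perp V_2$. Let $m=\dim V_1$, $k=\dim V_2$, and let $\{e_1,\dots,e_m\}$ and $\{\varepsilon_1,\dots,\varepsilon_k\}$ be orthonormal bases of $V_1$ and $V_2$. The left-invariant vector fields are $X_i(g)=dL_g(e_i)$, where $L_g(g')=gg'$. Points are written in exponential (logarithmic) coordinates $g=\exp(z+t)$, with $z=\sum z_ie_i\in V_1$ and $t=\sum t_s\varepsilon_s\in V_2$; group multiplication is $\exp(z+t)\exp(z'+t')=\exp(z+z'+t+t'+\tfrac12[z,z'])$. Define $J:V_2\to\mathrm{End}(V_1)$ by $\langle J(t)z,z'\rangle=\langle[z,z'],t\rangle$. The group $\mathbb G$ is of Heisenberg type if $J(t)$ is an orthogonal transformation of $V_1$ for every $t\in V_2$ with $|t|=1$. The homogeneous dimension is $Q=m+2k$, and $dg$ denotes Haar measure, i.e. the push-forward of Lebesgue measure on $\mathfrak g$ under $\exp$. The Folland–Kaplan gauge is $N(g)=(|z|^4+16|t|^2)^{1/4}$. For a smooth $u$, the horizontal gradient is $Xu=\sum_i (X_iu)X_i$, with $|Xu|=(\sum_i (X_iu)^2)^{1/2}$, and the symmetrized horizontal Hessian has entries $u_{,ij}=\tfrac12(X_iX_ju+X_jX_iu)$. The horizontal $p$-Laplacian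 is $\mathcal L_pu=\sum_{i=1}^m X_i(|Xu|^{p-2}X_iu)$, and the horizontal $\infty$-Laplacian is $\mathcal L_\infty u=\sum_{i,j}u_{,ij}X_iuX_ju$. For $p>2$ and sufficiently smooth $u$, ''$p$-superharmonic'' means $\mathcal L_pu\le 0$ and ''$p$-subharmonic'' means $\mathcal L_pu\ge0$, with derivatives taken in the strong sense. *)

(* Defs.v *)
From mathcomp Require Import all_boot all_order all_algebra.
From mathcomp Require Import all_classical all_reals all_analysis.
Import Order.TTheory GRing.Theory Num.Theory.
Import numFieldNormedType.Exports.
Local Open Scope ring_scope.

(* A step-two Carnot group G = exp(V1 (+) V2) written in exponential
   coordinates with respect to orthonormal bases e_1..e_m of V1 and
   eps_1..eps_k of V2:  a point is a pair (z, t) of row vectors.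
   The Lie bracket [V1,V1] -> V2 is encoded by its structure matrices
   c s (s < k):  <[z,z'], eps_s> = z (c s) z'^T. *)

Section Carnot.
Variables (R : realType) (m k : nat).

Definition G := ('rV[R]_m * 'rV[R]_k)%type.

Definition sqn {n} (v : 'rV[R]_n) : R := \sum_(i < n) v 0 i ^+ 2.

Definition dotr {n} (v w : 'rV[R]_n) : R := \sum_(i < n) v 0 i * w 0 i.

Variable c : 'I_k -> 'M[R]_m.

Definition bracket (z z' : 'rV[R]_m) : 'rV[R]_k :=
  \row_(s < k) (z *m c s *m z'^T) 0 0.

Definition gmul (g h : G) : G :=
  (g.1 + h.1, g.2 + h.2 + 2^-1 *: bracket g.1 h.1).

Definition ginv (g : G) : G := (- g.1, - g.2).

Definition expe (i : 'I_m) (s : R) : G := (s *: delta_mx 0 i, 0).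

(* J(t) as a matrix acting on row vectors: <J(t) z, z'> = z (Jmx t) z'^T
   = <[z,z'], t>. *)
Definition Jmx (t : 'rV[R]_k) : 'M[R]_m := \sum_(s < k) t 0 s *: c s.

Definition bracket_skew := forall s, (c s)^T = - c s.

Definition bracket_spans :=
  forall t : 'rV[R]_k,
    (forall z z' : 'rV[R]_m, dotr (bracket z z') t = 0) -> t = 0.

Definition Htype :=
  forall t : 'rV[R]_k, sqn t = 1 -> Jmx t *m (Jmx t)^T = 1%:M.

Definition gauge (g : G) : R :=
  Num.sqrt (Num.sqrt (sqn g.1 ^+ 2 + 16 * sqn g.2)).

Definition Xd (u : G -> R) (i : 'I_m) (g : G) : R :=
  derive1 (fun s : R => u (gmul g (expe i s))) 0.

Definition Xable (u : G -> R) (i : 'I_m) (g : G) : Prop :=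
  derivable (fun s : R => u (gmul g (expe i s))) 0 1.

Definition gradn (u : G -> R) (g : G) : R :=
  Num.sqrt (\sum_(i < m) Xd u i g ^+ 2).

Definition flux (p : R) (u : G -> R) (i : 'I_m) (g : G) : R :=
  powR (gradn u g) (p - 2) * Xd u i g.

Definition Lp (p : R) (u : G -> R) (g : G) : R :=
  \sum_(i < m) Xd (flux p u i) i g.

Definition hess (u : G -> R) (i j : 'I_m) (g : G) : R :=
  2^-1 * (Xd (Xd u j) i g + Xd (Xd u i) j g).

Definition Linf (u : G -> R) (g : G) : R :=
  \sum_(i < m) \sum_(j < m) hess u i j g * Xd u i g * Xd u j g.

Definition Lp_exists (p : R) (u : G -> R) : Prop :=
  forall (i : 'I_m) (g : G), Xable u i g /\ Xable (flux p u i) i g.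

Definition Linf_exists (u : G -> R) : Prop :=
  forall (i j : 'I_m) (g : G), Xable u i g /\ Xable (Xd u j) i g.

Definition p_superharmonic (p : R) (u : G -> R) : Prop :=
  Lp_exists p u /\ forall g, Lp p u g <= 0.

Definition p_subharmonic (p : R) (u : G -> R) : Prop :=
  Lp_exists p u /\ forall g, 0 <= Lp p u g.

Definition inf_subharmonic (u : G -> R) : Prop :=
  Linf_exists u /\ forall g, 0 <= Linf u g.

(* Haar measure = push-forward of Lebesgue measure on R^(m+k) under exp.
   Integration over R^n is written as an iterated Lebesgue integral over
   the coordinates (Fubini); coordinate 0 is the outermost integral. *)
Fixpoint iint (n : nat) (f : (nat -> R) -> R) : R :=
  match n with
  | 0 => f (fun _ => 0)
  | n'.+1 => fine (\int[@lebesgue_measure R]_x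
        ((iint n' (fun v => f (fun j => if j is j'.+1 then v j' else x)))%:E))%E
  end.

Definition of_coords (v : nat -> R) : G :=
  (\row_(i < m) v i, \row_(s < k) v (m + s)%N).

Definition haar_int (f : G -> R) : R := iint (m + k) (fun v => f (of_coords v)).

Definition Falpha (alpha : R) (rho : G -> R) (g : G) : R :=
  haar_int (fun g' => rho g' * powR (gauge (gmul (ginv g) g')) (- alpha)).

Definition F0 (rho : G -> R) (g : G) : R :=
  haar_int (fun g' => rho g' * ln (gauge (gmul (ginv g) g'))).

End Carnot.

Arguments bracket {R m k}. Arguments gmul {R m k}. Arguments ginv {R m k}.
Arguments expe {R m k}. Arguments Jmx {R m k}. Arguments bracket_skew {R m k}.
Arguments bracket_spans {R m k}. Arguments Htype {R m k}. Arguments gauge {R m k}.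
Arguments Xd {R m k}. Arguments Xable {R m k}. Arguments gradn {R m k}.
Arguments flux {R m k}. Arguments Lp {R m k}. Arguments hess {R m k}.
Arguments Linf {R m k}. Arguments Lp_exists {R m k}. Arguments Linf_exists {R m k}.
Arguments p_superharmonic {R m k}. Arguments p_subharmonic {R m k}.
Arguments inf_subharmonic {R m k}. Arguments of_coords {R m k}.
Arguments haar_int {R m k}. Arguments Falpha {R m k}. Arguments F0 {R m k}.

(* Main.v *)
(** Write [W = N^4 = |z|^4 + 16 |t|^2] and regularise the kernel [psi (W)], where [psi] is
    [x `^ (- alpha / 4)] or [ln x / 4], to [psi (W + e)]. The regularised potentials are smooth
    along the horizontal curves [g exp(s e_i)]. Their horizontal derivatives of order at most two
    have kernels which converge as [e -> 0] at the rate [C e^eta W^(-gam)] with [4 gam < Q], and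
    [W^(-gam)] is dominated by a product of powers [|x|^(-d)], [d < 1], of the coordinates. Hence
    these derivatives are locally uniformly Cauchy in [e], the potential has second
    horizontal derivatives, and they are limits of integrals of [X_i X_j (psi (W + e))] against
    [rho]. Since [L_p F] is, up to the factor [|XF|^(p - 4)], a linear expression in the second
    derivatives of [F] with coefficients depending only on [v = XF(g)], its sign follows from the
    pointwise sign of [|v|^2 tr H + (p - 2) <H v, v>], [H] the horizontal Hessian of
    [psi (W + e)]. On a group of Heisenberg type this is an explicit computation, using Bessel's
    inequality for the orthogonal vectors [z], [J(eps_1) z], ..., [J(eps_k) z] of equal norm. *)
Require Import Defs.
From mathcomp Require Import all_boot all_order all_algebra.
From mathcomp Require Import all_classical all_reals all_analysis.
From mathcomp Require Import measurable_realfun.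
From mathcomp Require Import ring lra.
Import Order.TTheory GRing.Theory Num.Theory.
Import numFieldNormedType.Exports.
Local Open Scope ring_scope.
Local Open Scope classical_set_scope.
Set Implicit Arguments.
Unset Strict Implicit.
Unset Printing Implicit Defensive.

(** * Iterated integrals of continuous functions with compact support *)

(** The density is merely continuous, so no derivative can be moved onto it: both derivatives fall
    on the kernel, whose second derivatives have size [W^(b - 1/2)] with [b = - alpha / 4], or
    [b = 0] for the logarithm. This is locally integrable when [0 < Q / 4 + b - 1/2], that is
    [alpha + 2 < Q], which every range of exponents in the theorem implies; hence no singular term
    appears at the pole. The slack in this inequality pays both for the rate [e^eta] and for keeping
    [d < 1]. The product weight suits iterated integrals because it splits into one-dimensional
    ones. As [|z_i| <= W^(1/4)] and [|t_r| <= W^(1/2)], it dominates [W^(- d Q / 4)], which is how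
    the homogeneous dimension governs integrability. [Q] enters a second time through the trace of
    the Hessian of [W], equal to [4 (Q + 2) |z|^2]. The critical exponent is the zero of
    [Q - p + 4 b (p - 1)], the coefficient that remains when Bessel's inequality is an equality. *)

Definition vcons {R : realType} (x : R) (v : nat -> R) : nat -> R :=
  fun j => if j is j'.+1 then v j' else x.

Lemma iintS (R : realType) n (f : (nat -> R) -> R) :
  iint R n.+1 f =
  Rintegral (@lebesgue_measure R) setT (fun x => iint R n (f \o vcons x)).
Proof. by []. Qed.

(* Sequential continuity makes the partial integrals of [f] continuous, hence measurable, by
   dominated convergence; no product measure is needed. *)
Definition test_fun {R : realType} (n : nat) (C L : R) (f : (nat -> R) -> R) :=
  [/\ forall v, `|f v| <= C,
      forall v i, (i < n)%N -> L < `|v i| -> f v = 0 &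
      forall (w : nat -> nat -> R) v, (forall i, (w ^~ i) @ \oo --> v i) ->
        (f \o w) @ \oo --> f v].

Section box.
Context {R : realType}.
Notation mu := (@lebesgue_measure R).
Implicit Types (f g : R -> R) (C L : R).

Definition box L : R -> R := \1_(`[- L, L]%classic).

Lemma boxE L x : box L x = (`|x| <= L)%R%:R.
Proof. by rewrite /box indicE mem_setE in_itv/= ler_norml. Qed.

Lemma integrable_box C L : mu.-integrable setT (EFin \o (fun x => C * box L x)).
Proof.
have /(integrableZl measurableT C) := integrable_indic_itv (- L) L true false.
exact: eq_integrable.
Qed.

Lemma Rintegral_box C L : 0 <= L -> Rintegral mu setT (fun x => C * box L x) = C * (2 * L).
Proof.
move=> L0; rewrite RintegralZl//; last first.
  by have := integrable_box 1 L; apply: eq_integrable => // x _ /=; rewrite mul1r.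
congr (_ * _); rewrite /Rintegral integral_indic// setIT.
have h : mu `[- L, L]%classic = (if (- L < L)%R then (L - - L)%:E else 0)%E.
  by have := @lebesgue_measure_itv R `[- L, L]%R; rewrite /= lte_fin.
apply: (etrans (congr1 fine h)); case: ifPn => [_|]; rewrite /=; first by ring.
by rewrite -leNgt => h'; lra.
Qed.

Lemma integrable_dom f g : measurable_fun setT f ->
  mu.-integrable setT (EFin \o g) -> (forall x, `|f x| <= g x) ->
  mu.-integrable setT (EFin \o f).
Proof.
move=> mf ig fg; apply: le_integrable ig => //; first exact/measurable_EFinP.
move=> x _ /=; rewrite lee_fin; apply: le_trans (fg x) _; exact: ler_norm.
Qed.

Lemma Rintegral_dom f g : measurable_fun setT f ->
  mu.-integrable setT (EFin \o g) -> (forall x, `|f x| <= g x) ->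
  `|Rintegral mu setT f| <= Rintegral mu setT g.
Proof.
move=> mf ig fg; have jf := integrable_dom mf ig fg.
apply: le_trans (le_normr_Rintegral _ jf) _ => //.
apply: le_Rintegral => //; exact: (integrable_norm jf).
Qed.

Lemma Rintegral_dct (h : nat -> R -> R) f g :
  (forall n, measurable_fun setT (h n)) ->
  (forall x, (h ^~ x) @ \oo --> f x) ->
  mu.-integrable setT (EFin \o g) -> (forall n x, `|h n x| <= g x) ->
  (fun n => Rintegral mu setT (h n)) @ \oo --> Rintegral mu setT f.
Proof.
move=> mh hf ig hg.
have mf : measurable_fun setT f by apply: measurable_fun_cvg mh _ => x _; exact: hf.
have [] := @dominated_convergence _ _ R mu setT measurableT
  (fun n => EFin \o h n) (EFin \o f) (EFin \o g).
- by move=> n; apply/measurable_EFinP; exact: mh.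
- by apply/measurable_EFinP; exact: mf.
- by apply: aeW => x _; apply: cvg_EFin; [exact: nearW|exact: hf].
- exact: ig.
- by apply: aeW => x n _ /=; rewrite lee_fin.
move=> jf _ hc; apply: fine_cvg.
rewrite /Rintegral fineK; last exact: integrable_fin_num.
exact: hc.
Qed.

End box.

Section iint_test_fun.
Context {R : realType}.
Notation mu := (@lebesgue_measure R).
Implicit Types (f g : (nat -> R) -> R) (C L : R).

Lemma test_fun_section n C L f x : test_fun n.+1 C L f -> test_fun n C L (f \o vcons x).
Proof.
move=> [fC fL fc]; split; first by move=> v; exact: fC.
- by move=> v i ni Lv; apply: (fL _ i.+1).
- move=> w v wv; apply: (fc (fun j => vcons x (w j))) => -[|i] /=.
    exact: cvg_cst.
  exact: wv.
Qed.

Lemma test_fun_section_supp n C L f x : test_fun n.+1 C L f -> L < `|x| ->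
  f \o vcons x = cst 0.
Proof. by move=> [_ fL _] Lx; apply/funext => v /=; apply: (fL _ 0). Qed.

Lemma test_fun0 n C L : 0 <= C -> test_fun n C L (cst 0).
Proof. by move=> C0; split=> [v|//|w v _]; [rewrite normr0|exact: cvg_cst]. Qed.

Lemma test_funD n C C' L f g : test_fun n C L f -> test_fun n C' L g ->
  test_fun n (C + C') L (fun v => f v + g v).
Proof.
move=> [fC fL fc] [gC gL gc]; split.
- by move=> v; apply: le_trans (ler_normD _ _) _; apply: lerD.
- by move=> v i ni Lv; rewrite (fL v i)// (gL v i)// addr0.
- by move=> w v wv; apply: cvgD; [exact: fc|exact: gc].
Qed.

Lemma test_funZ n C L f a : test_fun n C L f -> test_fun n (`|a| * C) L (fun v => a * f v).
Proof.
move=> [fC fL fc]; split.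
- by move=> v; rewrite normrM ler_wpM2l.
- by move=> v i ni Lv; rewrite (fL v i)// mulr0.
- by move=> w v wv; apply: cvgMr; exact: fc.
Qed.

Lemma iint0 n : iint R n (cst 0) = 0.
Proof.
elim: n => [//|n IH]; rewrite iintS.
under eq_Rintegral do rewrite (_ : _ \o _ = cst 0)// IH.
by rewrite /Rintegral integral0.
Qed.

(** The two claims need a common induction: sequential continuity in dimension [n] makes the partial
    integral a continuous, hence measurable, function of the outer variable, and the bound in
    dimension [n] supplies the majorant for dominated convergence in dimension [n + 1]. *)
Lemma iint_cvg n C L : 0 <= C -> 0 <= L ->
  (forall f, test_fun n C L f -> `|iint R n f| <= C * (2 * L) ^+ n) /\
  (forall (h : nat -> (nat -> R) -> R) f, (forall j, test_fun n C L (h j)) ->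
    test_fun n C L f -> (forall v, (h ^~ v) @ \oo --> f v) ->
    (fun j => iint R n (h j)) @ \oo --> iint R n f).
Proof.
move=> C0 L0; elim: n => [|n [IHb IHc]].
  split=> [f [fC _ _]|h f _ _ hf]; first by rewrite expr0 mulr1 /=.
  by apply: hf.
have bd f x : test_fun n.+1 C L f ->
    `|iint R n (f \o vcons x)| <= C * (2 * L) ^+ n * box L x.
  move=> gf; rewrite boxE; have [xL|Lx] := leP `|x| L; rewrite ?(mulr1, mulr0).
    exact/IHb/test_fun_section.
  by rewrite (test_fun_section_supp gf Lx) iint0 normr0.
have mf f : test_fun n.+1 C L f ->
    measurable_fun setT (fun x => iint R n (f \o vcons x)).
  move=> gf; apply: continuous_measurable_fun => x.
  apply/(@cvg_nbhsP _ R^o) => u ux; apply: IHc.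
  - by move=> j; apply: test_fun_section.
  - exact: test_fun_section.
  - move=> v; have [_ _ fc] := gf; apply: (fc (fun j => vcons (u j) v)) => -[|i] //=.
    exact: cvg_cst.
split=> [f gf|h f gh gf hf].
  rewrite iintS exprS mulrCA -mulrA [X in _ <= X](_ : _ = (C * (2 * L) ^+ n) * (2 * L)).
    by rewrite -Rintegral_box//; apply: Rintegral_dom;
      [exact: mf|exact: integrable_box|move=> x; exact: bd].
  by ring.
rewrite iintS; under eq_fun do rewrite iintS.
apply: (@Rintegral_dct R _ _ (fun x => (C * (2 * L) ^+ n) * box L x)).
- by move=> j; exact: mf.
- move=> x; apply: IHc => [j||v]; [exact: test_fun_section|exact: test_fun_section|exact: hf].
- exact: integrable_box.
- by move=> j x; exact: bd.
Qed.

Lemma iint_section n C L f : 0 <= C -> 0 <= L -> test_fun n.+1 C L f ->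
  measurable_fun setT (fun x => iint R n (f \o vcons x)) /\
  mu.-integrable setT (EFin \o (fun x => iint R n (f \o vcons x))).
Proof.
move=> C0 L0 gf.
have mf : measurable_fun setT (fun x => iint R n (f \o vcons x)).
  apply: continuous_measurable_fun => x.
  apply/(@cvg_nbhsP _ R^o) => u ux; apply: (iint_cvg n C0 L0).2.
  - by move=> j; apply: test_fun_section.
  - exact: test_fun_section.
  - move=> v; have [_ _ fc] := gf; apply: (fc (fun j => vcons (u j) v)) => -[|i] //=.
    exact: cvg_cst.
split=> //; apply: (@integrable_dom _ _ (fun x => (C * (2 * L) ^+ n) * box L x)) => //.
  exact: integrable_box.
move=> x; rewrite boxE; have [xL|Lx] := leP `|x| L; rewrite ?(mulr1, mulr0).
  exact/(iint_cvg n C0 L0).1/test_fun_section.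
by rewrite (test_fun_section_supp gf Lx) iint0 normr0.
Qed.

Lemma iintD n C C' L f g : 0 <= C -> 0 <= C' -> 0 <= L ->
  test_fun n C L f -> test_fun n C' L g ->
  iint R n (fun v => f v + g v) = iint R n f + iint R n g.
Proof.
move=> C0 C'0 L0; elim: n f g => [//|n IH] f g gf gg.
rewrite !iintS -RintegralD//.
- by apply: eq_Rintegral => x _; rewrite -IH//; apply: test_fun_section.
- exact: (iint_section C0 L0 gf).2.
- exact: (iint_section C'0 L0 gg).2.
Qed.

Lemma iintZ n C L f a : 0 <= C -> 0 <= L -> test_fun n C L f ->
  iint R n (fun v => a * f v) = a * iint R n f.
Proof.
move=> C0 L0; elim: n f => [//|n IH] f gf.
rewrite !iintS -RintegralZl//.
- by apply: eq_Rintegral => x _; rewrite -IH//; apply: test_fun_section.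
- exact: (iint_section C0 L0 gf).2.
Qed.

Lemma iint_ge0 n f : (forall v, 0 <= f v) -> 0 <= iint R n f.
Proof.
elim: n f => [f f0|n IH f f0]; first exact: f0.
by rewrite iintS; apply: Rintegral_ge0 => x _; apply: IH => v /=.
Qed.

End iint_test_fun.

(** * Iterated integrals of singular functions *)

Section phi.
Context {R : realType}.
Notation mu := (@lebesgue_measure R).

(** Monotone convergence along an exhaustion by compact intervals, on each of which the fundamental
    theorem of calculus applies. It handles a singularity at an endpoint of the union. *)
Lemma improper_le (h H : R -> R) (u v : nat -> R) (B : R) :
  (forall n, u n < v n) -> nonincreasing_seq u -> nondecreasing_seq v ->
  (forall n x, x \in `[u n, v n]%R -> 0 <= h x) ->
  (forall n x, x \in `[u n, v n]%R -> {for x, continuous h}) ->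
  (forall n x, x \in `[u n, v n]%R -> is_derive x 1 H (h x)) ->
  (forall n, H (v n) - H (u n) <= B) ->
  (\int[mu]_(x in \bigcup_n `[u n, v n]) (h x)%:E <= B%:E)%E.
Proof.
move=> uv du iv h0 hc dH HB.
have hcW n : {within `[u n, v n], continuous h}.
  apply: continuous_in_subspaceT => x /set_mem xI; apply: (hc n).
  exact: xI.
have cI : (\int[mu]_(x in `[u n, v n]) (h x)%:E)%E @[n --> \oo] -->
    (\int[mu]_(x in \bigcup_n `[u n, v n]) (h x)%:E)%E.
  apply: ge0_nondecreasing_set_cvg_integral.
  - move=> i j ij; rewrite subsetEset => x /=; rewrite !in_itv/= => /andP[a b].
    by rewrite (le_trans (du _ _ ij))//= (le_trans b)// iv.
  - by move=> i; exact: measurable_itv.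
  - move=> i; apply/measurable_EFinP.
    by apply: subspace_continuous_measurable_fun => //; exact: measurable_itv.
  - by move=> i x /= xI; rewrite lee_fin; apply: (h0 i).
rewrite -(cvg_lim _ cI)//; apply: lime_le.
  by apply/cvg_ex; eexists; exact: cI.
apply: nearW => n.
have oo x : x \in `]u n, v n[%R -> x \in `[u n, v n]%R.
  by apply: subset_itv_oo_cc.
have cH x : x \in `[u n, v n]%R -> H z @[z --> x] --> H x.
  move=> xI; apply: differentiable_continuous; apply/derivable1_diffP.
  by have [] := dH _ _ xI.
rewrite (@continuous_FTC2 _ h H)//.
- by rewrite -EFinB lee_fin HB.
- split.
  + by move=> x /oo xI; have [] := dH _ _ xI.
  + by apply: cvg_at_right_filter; apply: cH; rewrite in_itv/= lexx ltW.
  + by apply: cvg_at_left_filter; apply: cH; rewrite in_itv/= lexx ltW.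
- by move=> x /oo xI; rewrite derive1E; have [_ ->] := dH _ _ xI.
Qed.

(** The truncated one-dimensional weight. For [d != 0] its value at the singular point [0] is [0],
    by the convention for powers of zero. *)
Definition phi (d L x : R) : R := `|x| `^ (- d) * box L x.

Lemma phi_ge0 (d L x : R) : 0 <= phi d L x.
Proof. by rewrite /phi mulr_ge0 ?powR_ge0// boxE; case: leP. Qed.

Lemma measurable_phi (d L a : R) : measurable_fun setT (fun x : R => phi d L (x - a)).
Proof.
have ms : measurable_fun setT (fun x : R => x - a).
  by apply: continuous_measurable_fun => x; apply: cvgB; [exact: cvg_id|exact: cvg_cst].
apply: measurable_funM.
  apply: (measurableT_comp (measurable_powR (- d))).
  apply: continuous_measurable_fun => x; apply: cvg_norm.
  by apply: cvgB; [exact: cvg_id|exact: cvg_cst].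
apply: (measurableT_comp _ ms).
by apply: measurable_indic; exact: measurable_itv.
Qed.

Lemma phi_right (d L a : R) : 0 < d -> d < 1 -> 0 < L ->
  (\int[mu]_(x in `]a, (a + L)%R]%classic) (phi d L (x - a))%:E <= (L `^ (1 - d) / (1 - d))%:E)%E.
Proof.
move=> d0 d1 L0; have d1' : 0 < 1 - d by rewrite subr_gt0.
(* The denominator [n + 2], rather than [n + 1], keeps [r n < L], so that no interval of the
   exhaustion is degenerate. *)
pose r n : R := L / n.+2%:R.
have r0 n : 0 < r n by rewrite divr_gt0.
have rL n : r n < L by rewrite /r ltr_pdivrMr// ltr_pMr// ltr1n.
have dr n : (r n.+1 <= r n) by rewrite /r ler_pM2l// lef_pV2 ?posrE// ler_nat.
have DE : `]a, a + L] = \bigcup_n `[a + r n, a + L] :> set R.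
  apply/seteqP; split => x /=.
    rewrite in_itv/= => /andP[ax xL].
    have xa : 0 < (x - a) / L by rewrite divr_gt0// subr_gt0.
    have [n _ hn] : \forall n \near \oo, @harmonic R n < (x - a) / L.
      by move/cvgr_lt : (@cvg_harmonic R); apply.
    exists n => //=; rewrite in_itv/= xL andbT -lerBrDl /r.
    have /ltW := hn n (leqnn n); rewrite /= /harmonic ler_pdivlMr// mulrC => h.
    apply: le_trans h; rewrite ler_pM2l// lef_pV2 ?posrE// ler_nat//.
  by move=> [n _] /=; rewrite !in_itv/= => /andP[h ->]; rewrite (lt_le_trans _ h)// ltrDl.
rewrite DE.
under eq_integral => x.
  rewrite inE => -[n _] /=; rewrite in_itv/= => /andP[h1 h2].
  have xa : 0 < x - a by rewrite subr_gt0 (lt_le_trans _ h1)// ltrDl.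
  rewrite /phi boxE gtr0_norm// lerBlDl h2 mulr1.
  over.
have pos n x : x \in `[a + r n, a + L]%R -> 0 < x - a.
  by rewrite in_itv/= => /andP[h _]; rewrite subr_gt0 (lt_le_trans _ h)// ltrDl.
have dS (x : R) : is_derive x 1 (fun y : R => y - a) 1.
  by apply: is_derive_eq; rewrite subr0.
apply: (@improper_le (fun x => (x - a) `^ (- d))
   (fun x => (1 - d)^-1 * (x - a) `^ (1 - d)) (fun n => a + r n) (fun=> a + L)).
- by move=> n; rewrite ltrD2l.
- by apply/nonincreasing_seqP => n; rewrite lerD2l.
- by move=> ? ? _.
- by move=> n x _; exact: powR_ge0.
- move=> n x /pos xa; apply: (@differentiable_continuous _ R^o R^o); apply/derivable1_diffP.
  have := @is_derive1_comp _ (fun y => y `^ (- d)) (fun y => y - a) x _ _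
     (is_derive1_powR _ xa) (dS x).
  by case.
- move=> n x /pos xa.
  have h := @is_derive1_comp _ (fun y => y `^ (1 - d)) (fun y => y - a) x _ _
     (is_derive1_powR _ xa) (dS x).
  apply: is_derive_eq.
  rewrite /= !mulr1 addrAC subrr add0r -[_ *: _]/(_ * _) mulrA mulVf ?mul1r//.
  by rewrite gt_eqF.
- move=> n; rewrite addrAC subrr add0r mulrC -[X in _ <= X]subr0 lerB//.
  by rewrite mulr_ge0 ?powR_ge0// invr_ge0 ltW.
Qed.

Lemma phi_left (d L a : R) : 0 < d -> d < 1 -> 0 < L ->
  (\int[mu]_(x in `[(a - L)%R, a[%classic) (phi d L (x - a))%:E <= (L `^ (1 - d) / (1 - d))%:E)%E.
Proof.
move=> d0 d1 L0; have d1' : 0 < 1 - d by rewrite subr_gt0.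
pose r n : R := L / n.+2%:R.
have r0 n : 0 < r n by rewrite divr_gt0.
have rL n : r n < L by rewrite /r ltr_pdivrMr// ltr_pMr// ltr1n.
have dr n : (r n.+1 <= r n) by rewrite /r ler_pM2l// lef_pV2 ?posrE// ler_nat.
have DE : `[a - L, a[ = \bigcup_n `[a - L, a - r n] :> set R.
  apply/seteqP; split => x /=.
    rewrite in_itv/= => /andP[ax xL].
    have xa : 0 < (a - x) / L by rewrite divr_gt0// subr_gt0.
    have [n _ hn] : \forall n \near \oo, @harmonic R n < (a - x) / L.
      by move/cvgr_lt : (@cvg_harmonic R); apply.
    exists n => //=; rewrite in_itv/= ax lerBrDr -lerBrDl /r.
    have /ltW := hn n (leqnn n); rewrite /= /harmonic ler_pdivlMr// mulrC => h.
    apply: le_trans h; rewrite ler_pM2l// lef_pV2 ?posrE// ler_nat//.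
  move=> [n _] /=; rewrite !in_itv/= => /andP[-> h]; rewrite (le_lt_trans h)//.
  by rewrite ltrBlDr ltrDl.
rewrite DE.
have pos n x : x \in `[a - L, a - r n]%R -> 0 < a - x.
  rewrite in_itv/= => /andP[_ h]; rewrite subr_gt0 (le_lt_trans h)//.
  by rewrite ltrBlDr ltrDl.
under eq_integral => x.
  rewrite inE => -[n _] /= xI; have xa := pos _ _ xI.
  move: xI; rewrite in_itv/= => /andP[h1 h2].
  rewrite /phi boxE distrC gtr0_norm// lerBlDl -lerBlDr h1 mulr1.
  over.
have dS (x : R) : is_derive x 1 (fun y : R => a - y) (-1).
  by have h := @is_deriveB _ _ _ (cst a) id x 1 0 1 _ _; rewrite sub0r in h; exact: h.
apply: (@improper_le (fun x => (a - x) `^ (- d))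
   (fun x => - ((1 - d)^-1) * (a - x) `^ (1 - d)) (fun=> a - L) (fun n => a - r n)).
- by move=> n; rewrite ltrD2l ltrN2.
- by move=> ? ? _.
- by apply/nondecreasing_seqP => n; rewrite lerD2l lerN2.
- by move=> n x _; exact: powR_ge0.
- move=> n x /pos xa; apply: (@differentiable_continuous _ R^o R^o); apply/derivable1_diffP.
  have := @is_derive1_comp _ (fun y => y `^ (- d)) (fun y => a - y) x _ _
     (is_derive1_powR _ xa) (dS x).
  by case.
- move=> n x /pos xa.
  have h := @is_derive1_comp _ (fun y => y `^ (1 - d)) (fun y => a - y) x _ _
     (is_derive1_powR _ xa) (dS x).
  apply: is_derive_eq.
  rewrite /= -[_ *: _]/(_ * _) addrAC subrr add0r mulrN1 mulrNN mulrA mulVf ?mul1r//.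
  by rewrite gt_eqF.
- move=> n; rewrite !subKr !mulNr opprK addrC [X in X - _]mulrC.
  by rewrite -[X in _ <= X]subr0 lerB// mulr_ge0 ?powR_ge0// invr_ge0 ltW.
Qed.

(** The bound must not depend on the centre [a]: in the iterated integral the centre for one
    coordinate moves with the coordinates integrated outside it. *)
Lemma phi_int (d L : R) : 0 < d -> d < 1 -> 0 < L -> exists2 c, 0 <= c &
  forall a, mu.-integrable setT (EFin \o (fun x => phi d L (x - a))) /\
            Rintegral mu setT (fun x => phi d L (x - a)) <= c.
Proof.
move=> d0 d1 L0; exists (2 * (L `^ (1 - d) / (1 - d))).
  by rewrite mulr_ge0// divr_ge0 ?powR_ge0// subr_ge0 ltW.
move=> a; pose f x := phi d L (x - a).
have mf : measurable_fun setT f := measurable_phi d L a.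
have mfe : measurable_fun setT (EFin \o f) by apply/measurable_EFinP; exact: mf.
have f0 x : 0 <= f x by exact: phi_ge0.
have le : (\int[mu]_x (f x)%:E <= (2 * (L `^ (1 - d) / (1 - d)))%:E)%E.
  (* The two half-open intervals omit only the centre [a] from the support, and [phi] vanishes
     there. *)
  rewrite [leLHS](_ : _ = \int[mu]_(x in `]a, (a + L)%R]%classic `|` `[(a - L)%R, a[%classic) (f x)%:E)%E; last first.
    rewrite [RHS]integral_mkcond; apply: eq_integral => x _ /=; rewrite patchE.
    case: ifPn => //; rewrite notin_setE /= => /not_orP[]; rewrite !in_itv/= => h1 h2.
    congr EFin; rewrite /f /phi boxE.
    have [->|xa] := eqVneq x a; first by rewrite subrr normr0 powR0 ?mul0r// oppr_eq0 gt_eqF.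
    case: (leP `|x - a| L); rewrite ?mulr0// ler_norml => /andP[h3 h4]; exfalso.
    move: xa; rewrite neq_lt => /orP[] xa; [apply: h2|apply: h1]; apply/andP; split => //; lra.
  rewrite ge0_integral_setU//=.
  - by rewrite mulr_natl mulr2n EFinD leeD//; [exact: phi_right|exact: phi_left].
  - by apply: measurable_funS mfe.
  - by move=> x _; rewrite lee_fin.
  - apply/disj_setPLR => x /=; rewrite !in_itv/= => /andP[h1 _] /andP[_ h2].
    by have := lt_trans h1 h2; rewrite ltxx.
have jf : mu.-integrable setT (EFin \o f).
  apply/integrableP; split => //.
  under eq_integral => x _ do rewrite /= ger0_norm//.
  by apply: le_lt_trans le _; exact: ltry.
split=> //; rewrite -lee_fin /Rintegral fineK//.
exact: integrable_fin_num.
Qed.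

(** Allows a majorant to take any prescribed value at one point at no cost. *)
Lemma Rintegral_point (a b : R) :
  mu.-integrable setT (EFin \o (fun x => b * \1_[set a] x)) /\
  Rintegral mu setT (fun x => b * \1_[set a] x) = 0.
Proof.
have i1 : mu.-integrable setT (EFin \o (\1_[set a] : R -> R)).
  apply: (@integrable_dom _ _ (fun x => 1 * box `|a| x)).
  - by apply: measurable_indic; exact: measurable_set1.
  - exact: integrable_box.
  - move=> x; rewrite boxE mul1r indicE; case: (boolP (x \in _)) => [|_].
      by rewrite inE => ->; rewrite lexx normr1.
    by rewrite /= normr0 ler0n.
split; first by have := integrableZl measurableT b i1; apply: eq_integrable.
rewrite RintegralZl//; have h : mu [set a] = 0%E by exact: lebesgue_measure_set1.
rewrite [X in _ * X](_ : _ = 0) ?mulr0// /Rintegral integral_indic ?setIT//.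
  exact: (congr1 fine h).
Qed.

(* Nothing is known about [f] on the graphs [v i = a i v], where the integrands of the theorem
   take junk values and inner integrals may diverge; away from the point [a 0] the partial
   integral of [f] is a limit of those of [h j], which gives its measurability. *)
Lemma iint_sing (d L c : R) n (f : (nat -> R) -> R) (h : nat -> (nat -> R) -> R)
    (C w : nat -> R) (B : R) (a : nat -> (nat -> R) -> R) :
  0 <= c ->
  (forall b, mu.-integrable setT (EFin \o (fun x => phi d L (x - b))) /\
             Rintegral mu setT (fun x => phi d L (x - b)) <= c) ->
  0 <= B -> (forall j, 0 <= C j) -> (forall j, test_fun n (C j) B (h j)) ->
  (forall i v v', (forall j, (j < i)%N -> v j = v' j) -> a i v = a i v') ->
  (forall j, 0 <= w j) -> w @ \oo --> 0 ->
  (forall j v, (forall i, (i < n)%N -> v i != a i v) ->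
    `|f v - h j v| <= w j * \prod_(i < n) phi d L (v i - a i v)) ->
  forall j, `|iint R n f - iint R n (h j)| <= w j * c ^+ n.
Proof.
move=> c0 hc B0 C0; elim: n f h w a => [|n IH] f h w a gh ha w0 wc fh j.
  have := fh j (fun=> 0); rewrite big_ord0 expr0.
  by apply.
pose a0 := a 0 (cst 0).
have a0E v : a 0 v = a0 by apply: ha.
pose F x := iint R n (f \o vcons x).
pose H j x := iint R n (h j \o vcons x).
(* The induction hypothesis on the slice at [x], with rate [w i * phi d L (x - a0)]. For fixed [x]
   this still tends to [0], as the hypothesis on rates demands. *)
have FH j' x : x != a0 -> `|F x - H j' x| <= w j' * phi d L (x - a0) * c ^+ n.
  move=> xa; apply: (IH (f \o vcons x) (fun i => h i \o vcons x)
    (fun i => w i * phi d L (x - a0)) (fun i v => a i.+1 (vcons x v))).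
  - by move=> i; exact: test_fun_section.
  - by move=> i v v' vv; apply: ha => -[|k] //= ki; exact: vv.
  - by move=> i; rewrite mulr_ge0 ?phi_ge0.
  - by rewrite -[X in _ --> X](mul0r (phi d L (x - a0))); apply: cvgMl.
  - move=> i v vi; have := fh i (vcons x v); rewrite big_ord_recl /= a0E mulrA.
    by apply=> -[|k] //= ki; [rewrite a0E|exact: vi].
have mH i := (iint_section (C0 i) B0 (gh i)).1.
have iH i := (iint_section (C0 i) B0 (gh i)).2.
have m1 : measurable_fun setT (\1_[set a0] : R -> R).
  by apply: measurable_indic; exact: measurable_set1.
have mF : measurable_fun setT F.
  (* The [H i] converge to [F] only off [a0]; correcting them to the value [F a0] at that point
     gives convergence everywhere. *)
  apply: (@measurable_fun_cvg _ _ _ _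
    (fun i x => H i x * (1 - \1_[set a0] x) + F a0 * \1_[set a0] x)).
    move=> i; apply: measurable_funD; apply: measurable_funM => //.
      exact: mH.
    by apply: measurable_funB.
  move=> x _; rewrite /= indicE; have [->|xa] := eqVneq x a0.
    rewrite mem_set//= subrr mulr1; under eq_fun do rewrite mulr0 add0r.
    exact: cvg_cst.
  rewrite memNset/=; last by move=> /eqP; apply/negP.
  under eq_fun do rewrite subr0 mulr1 mulr0 addr0.
  apply/cvgrPdist_le => e e0.
  have : (fun i => w i * phi d L (x - a0) * c ^+ n) @ \oo --> 0.
    rewrite -[X in _ --> X](mul0r (c ^+ n)); apply: cvgMl.
    by rewrite -[X in _ --> X](mul0r (phi d L (x - a0))); apply: cvgMl.
  move=> /cvgrPdist_le/(_ _ e0); apply: filterS => i.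
  rewrite sub0r normrN ger0_norm; last by rewrite !mulr_ge0 ?phi_ge0 ?exprn_ge0.
  by apply: le_trans; exact: FH.
(* The second term absorbs the uncontrolled difference at [a0] and integrates to [0]. *)
pose g x := w j * c ^+ n * phi d L (x - a0) + `|F a0 - H j a0| * \1_[set a0] x.
have g1 : mu.-integrable setT (EFin \o (fun x => w j * c ^+ n * phi d L (x - a0))).
  by have := integrableZl measurableT (w j * c ^+ n) (hc a0).1; apply: eq_integrable.
have [g2 g20] := Rintegral_point a0 (`|F a0 - H j a0|).
have ig : mu.-integrable setT (EFin \o g).
  by have := integrableD measurableT g1 g2; apply: eq_integrable.
have FHg x : `|F x - H j x| <= g x.
  rewrite /g indicE; have [->|xa] := eqVneq x a0.
    by rewrite mem_set// mulr1 lerDr !mulr_ge0 ?phi_ge0 ?exprn_ge0.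
  rewrite memNset/=; last by move=> /eqP; apply/negP.
  by rewrite mulr0 addr0 mulrAC FH.
have mFH : measurable_fun setT (fun x => F x - H j x).
  by apply: measurable_funB => //; exact: mH.
have iFH := integrable_dom mFH ig FHg.
have iF : mu.-integrable setT (EFin \o F).
  have := integrableD measurableT iFH (iH j); apply: eq_integrable => // x _ /=.
  by rewrite -EFinD subrK.
rewrite !iintS -(RintegralB measurableT iF (iH j)).
apply: le_trans (Rintegral_dom mFH ig FHg) _.
rewrite RintegralD// g20 addr0 RintegralZl//; last exact: (hc a0).1.
by rewrite exprSr mulrA ler_wpM2l ?mulr_ge0 ?exprn_ge0//; exact: (hc a0).2.
Qed.

End phi.

(** * Derivatives of functions of one variable *)

Section calculus.
Context {R : realType}.
Implicit Types (f df : R -> R).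

Lemma is_derive_cvg_self f (x l : R) : is_derive x 1 f l -> f z @[z --> x] --> f x.
Proof.
by case=> fd _; apply: differentiable_continuous; apply/derivable1_diffP.
Qed.

Lemma MVT_norm f df (s : R) : (forall x : R, is_derive x 1 f (df x)) ->
  exists2 x, `|x| <= `|s| & f s - f 0 = df x * s.
Proof.
move=> fd.
have fc a b : {within `[a, b], continuous f}.
  apply: continuous_subspaceT => x; apply: differentiable_continuous.
  by apply/derivable1_diffP; have [] := fd x.
have [s0|s0] := leP 0 s.
  have [x] := MVT_segment s0 (fun x _ => fd x) (fc _ _).
  rewrite in_itv/= subr0 => /andP[x0 xs] fE; exists x => //.
  by rewrite !ger0_norm.
have [x] := MVT_segment (ltW s0) (fun x _ => fd x) (fc _ _).
rewrite in_itv/= sub0r => /andP[xs x0] fE; exists x.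
  by rewrite ler0_norm// ltr0_norm// lerN2.
by rewrite -[f s - f 0]opprB fE mulrN opprK.
Qed.

Lemma is_derive_cvg f (a l : R) :
  (fun h => h^-1 * (f (a + h) - f a)) @ 0^' --> l -> is_derive a 1 f l.
Proof.
move=> fl.
have fE : (fun h => h^-1 *: (f (h *: (1 : R) + a) - f a)) =
    (fun h => h^-1 * (f (a + h) - f a)).
  by apply/funext => h; rewrite -[h *: (1 : R)]/(h * 1) mulr1 [a + h]addrC.
split; first by apply/cvg_ex; exists l; rewrite fE.
by rewrite /derive fE; exact: cvg_lim.
Qed.

Lemma is_derive_eps f (a l : R) :
  (forall e, 0 < e -> exists2 d, 0 < d &
     forall h, `|h| < d -> `|f (a + h) - f a - h * l| <= e * `|h|) ->
  is_derive a 1 f l.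
Proof.
move=> fl; apply: is_derive_cvg; apply/cvgrPdist_le => e e0.
have [d d0 fd] := fl _ e0.
exists d => //= h; rewrite /ball/= sub0r normrN => hd h0.
have h0' : 0 < `|h| by rewrite normr_gt0.
rewrite -(ler_pM2r h0') -normrM mulrBl mulrAC mulVf ?mul1r// -normrN opprB.
by rewrite [l * h]mulrC; exact: fd.
Qed.

Lemma is_derive_epsP f (a l : R) : is_derive a 1 f l ->
  forall e, 0 < e -> exists2 d, 0 < d &
     forall h, `|h| < d -> `|f (a + h) - f a - h * l| <= e * `|h|.
Proof.
move=> [/cvg_ex[l' fl'] lE] e e0.
have ll : l' = l by rewrite -lE; apply/esym; exact: cvg_lim fl'.
rewrite {l'}ll in fl'.
move: fl' => /cvgrPdist_le/(_ _ e0)[d /= d0 fd]; exists d => // h hd.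
have [->|h0] := eqVneq h 0.
  by rewrite addr0 subrr mul0r subrr !normr0 mulr0.
have h0' : 0 < `|h| by rewrite normr_gt0.
have := fd h; rewrite /ball/= sub0r normrN => /(_ hd h0).
rewrite -[h *: (1 : R)]/(h * 1) mulr1 [h + a]addrC -[_ *: _]/(_ * _).
rewrite -(ler_pM2r h0') -normrM mulrBl mulrAC mulVf ?mul1r// -normrN opprB.
by rewrite [l * h]mulrC.
Qed.

Lemma is_derive_quad f (l C : R) :
  (forall s, `|s| <= 1 -> `|f s - f 0 - s * l| <= C * s ^+ 2) ->
  is_derive (0 : R) 1 f l.
Proof.
move=> fC; apply: is_derive_eps => e e0.
have C1 : 0 < `|C| + 1 by rewrite ltr_wpDl.
exists (Num.min 1 (e / (`|C| + 1))); first by rewrite lt_min ltr01 divr_gt0.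
move=> h; rewrite lt_min => /andP[h1 h2]; rewrite add0r.
apply: le_trans (fC _ (ltW h1)) _.
rewrite -[h ^+ 2]real_normK ?num_real// expr2 mulrA ler_wpM2r//.
move: h2; rewrite ltr_pdivlMr// => /ltW; apply: le_trans.
rewrite [leRHS]mulrC; apply: ler_wpM2r => //.
by rewrite (le_trans (ler_norm _))// lerDl.
Qed.

Lemma taylor2 f df ddf (C : R) :
  (forall x : R, is_derive x 1 f (df x)) -> (forall x : R, is_derive x 1 df (ddf x)) ->
  (forall x, `|x| <= 1 -> `|ddf x| <= C) ->
  forall s, `|s| <= 1 -> `|f s - f 0 - s * df 0| <= C * s ^+ 2.
Proof.
move=> fd dfd fC s s1.
have [x xs ->] := MVT_norm s fd.
have [y yx E] := MVT_norm x dfd.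
rewrite [s * _]mulrC -mulrBl E !normrM -[s ^+ 2]real_normK ?num_real// expr2 mulrA.
rewrite ler_wpM2r// ler_pM//.
by apply: fC; rewrite (le_trans yx)// (le_trans xs).
Qed.

(** Term-by-term differentiation: the mean value theorem for [fn N - fn n] turns the uniform Cauchy
    rate of the derivatives into a Lipschitz bound with constant [w N], which survives the limit in
    [n]. Only pointwise convergence of the functions themselves is then required. *)
Lemma derive_limit (fn dfn : nat -> R -> R) f (w : nat -> R) :
  (forall n (x : R), is_derive x 1 (fn n) (dfn n x)) ->
  (forall x, (fn ^~ x) @ \oo --> f x) ->
  w @ \oo --> 0 ->
  (forall n n' x, (n <= n')%N -> `|x| <= 1 -> `|dfn n x - dfn n' x| <= w n) ->
  exists2 l, (dfn ^~ 0) @ \oo --> l & is_derive (0 : R) 1 f l.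
Proof.
move=> fd ff w0 dw.
have wN e : 0 < e -> exists2 N, w N < e & forall n, (N <= n)%N -> w n < e.
  move=> e0; move: (w0) => /cvgrPdist_lt/(_ _ e0)[N _ hN].
  have hw n : (N <= n)%N -> w n < e.
    by move=> /hN; rewrite /= sub0r normrN; apply: le_lt_trans; exact: ler_norm.
  by exists N => //; apply: hw.
have cv : cvg ((dfn ^~ 0) @ \oo).
  apply/cauchy_cvgP/cauchy_exP => e e0.
  have [N _ hw] := wN _ e0.
  exists (dfn N 0); exists N => // n /= Nn; rewrite /ball/=.
  by apply: le_lt_trans (hw N (leqnn N)); apply: dw => //; rewrite normr0.
have /cvg_ex[/= l dl] := cv.
exists l => //; apply: is_derive_eps => e e0.
have e4 : 0 < e / 4 by rewrite divr_gt0.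
have [N wNe hw] := wN _ e4.
have dN : `|dfn N 0 - l| <= w N.
  have cl : `|dfn N 0 - dfn n 0| @[n --> \oo] --> `|dfn N 0 - l|.
    by apply: cvg_norm; apply: cvgB => //; exact: cvg_cst.
  rewrite -(cvg_lim _ cl)//; apply: limr_le; first by apply/cvg_ex; eexists; exact: cl.
  by exists N => // n /= Nn; apply: dw => //; rewrite normr0.
have fN s : `|s| <= 1 -> `|(fn N s - f s) - (fn N 0 - f 0)| <= w N * `|s|.
  move=> s1.
  have cl : `|(fn N s - fn n s) - (fn N 0 - fn n 0)| @[n --> \oo] -->
      `|(fn N s - f s) - (fn N 0 - f 0)|.
    apply: cvg_norm; apply: cvgB; apply: cvgB; try exact: cvg_cst; exact: ff.
  rewrite -(cvg_lim _ cl)//; apply: limr_le; first by apply/cvg_ex; eexists; exact: cl.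
  exists N => // n /= Nn.
  have [x xs /= ->] := @MVT_norm (fun s => fn N s - fn n s)
    (fun s => dfn N s - dfn n s) s (fun x => is_deriveB (fd N x) (fd n x)).
  by rewrite normrM ler_wpM2r// dw// (le_trans xs).
have e2 : 0 < e / 2 by rewrite divr_gt0.
have [d d0 hd] := is_derive_epsP (fd N 0) e2.
exists (Num.min 1 d); first by rewrite lt_min ltr01.
move=> h; rewrite lt_min => /andP[/ltW h1 /hd]; rewrite !add0r => hh.
have := fN _ h1; have : `|h * (dfn N 0 - l)| <= w N * `|h|.
  by rewrite normrM mulrC ler_wpM2r.
have : w N * `|h| <= e / 4 * `|h| by rewrite ler_wpM2r// ltW.
move: hh; set H := `|h|; rewrite !ler_norml => /andP[a1 a2] a3 /andP[b1 b2] /andP[c1 c2].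
apply/andP; split; lra.
Qed.

End calculus.

(** * Horizontal derivatives *)

Section group.
Context {R : realType} {m k : nat} (c : 'I_k -> 'M[R]_m).
Hypothesis csk : bracket_skew c.
Notation G := (G R m k).
Implicit Types (g h : G) (z : 'rV[R]_m) (t : 'rV[R]_k).

Lemma skewE r i j : c r j i = - c r i j.
Proof. by have /matrixP/(_ i j) := csk r; rewrite !mxE. Qed.

Lemma rowDE n (u v : 'rV[R]_n) i : (u + v) 0 i = u 0 i + v 0 i.
Proof. by rewrite mxE. Qed.

Lemma rowZE n a (v : 'rV[R]_n) i : (a *: v) 0 i = a * v 0 i.
Proof. by rewrite mxE. Qed.

Lemma rowNE n (v : 'rV[R]_n) i : (- v) 0 i = - v 0 i.
Proof. by rewrite mxE. Qed.

(** The [i]-th coordinate of [J(eps_r) z]. *)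
Definition cz (r : 'I_k) z (i : 'I_m) : R := \sum_l z 0 l * c r l i.

Lemma czE r z i : (z *m c r) 0 i = cz r z i.
Proof. by rewrite mxE. Qed.

Lemma czD r z z' i : cz r (z + z') i = cz r z i + cz r z' i.
Proof. by rewrite -!czE mulmxDl rowDE. Qed.

Lemma czZ r a z i : cz r (a *: z) i = a * cz r z i.
Proof. by rewrite -!czE -scalemxAl rowZE. Qed.

Lemma cz_delta r i j : cz r (delta_mx 0 i) j = c r i j.
Proof. by rewrite -czE -rowE mxE. Qed.

Lemma bracketE z z' r : bracket c z z' 0 r = \sum_i cz r z i * z' 0 i.
Proof. by rewrite mxE mxE; apply: eq_bigr => i _; rewrite czE !mxE. Qed.

Lemma bracketDl x y z : bracket c (x + y) z = bracket c x z + bracket c y z.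
Proof. by apply/rowP => r; rewrite rowDE mxE !mulmxDl rowDE !mxE. Qed.

Lemma bracketDr x y z : bracket c x (y + z) = bracket c x y + bracket c x z.
Proof. by apply/rowP => r; rewrite rowDE mxE linearD mulmxDr rowDE !mxE. Qed.

Lemma gmulA g h h' : gmul c (gmul c g h) h' = gmul c g (gmul c h h').
Proof.
case: g h h' => [z t] [z1 t1] [z2 t2]; rewrite /gmul /= addrA bracketDl bracketDr.
congr (_, _); apply/rowP => r; rewrite !(rowDE, rowZE).
by ring.
Qed.

Lemma bracket_delta z i s r : bracket c z (s *: delta_mx 0 i) 0 r = s * cz r z i.
Proof.
rewrite bracketE (bigD1 i)//= big1 ?addr0; first by rewrite !mxE !eqxx mulr1 mulrC.
by move=> j ji; rewrite !mxE (negbTE ji) andbF !mulr0.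
Qed.

Lemma curve_z h i s j : (gmul c h (Defs.expe i s)).1 0 j = h.1 0 j + s * (j == i)%:R.
Proof. by rewrite /= rowDE rowZE mxE eqxx. Qed.

Lemma curve_t h i s r :
  (gmul c h (Defs.expe i s)).2 0 r = h.2 0 r + s * (2^-1 * cz r h.1 i).
Proof. by rewrite /= addr0 rowDE rowZE bracket_delta mulrCA. Qed.

Lemma curve_cz h i s r j :
  cz r (gmul c h (Defs.expe i s)).1 j = cz r h.1 j + s * c r i j.
Proof. by rewrite /= czD czZ cz_delta. Qed.

Lemma expeD h i s s' :
  gmul c (gmul c h (Defs.expe i s)) (Defs.expe i s') = gmul c h (Defs.expe i (s + s')).
Proof.
rewrite gmulA; congr gmul; rewrite /gmul/= /Defs.expe -scalerDl; congr (_, _).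
apply/rowP => r; rewrite !add0r rowZE bracket_delta czZ cz_delta.
(* Skewness gives [[e_i, e_i] = 0], so that [exp(s e_i)] is a one-parameter subgroup. *)
by have := skewE r i i; rewrite mxE => e; suff -> : c r i i = 0; [ring|lra].
Qed.

Lemma expe0 h i : gmul c h (Defs.expe i 0) = h.
Proof.
case: h => z t; rewrite /gmul/=; congr (_, _); first by rewrite scale0r addr0.
by apply/rowP => r; rewrite !rowDE rowZE bracket_delta mxE; ring.
Qed.

Definition dX (i : 'I_m) (u u' : G -> R) :=
  forall h, is_derive (0 : R) 1 (fun s => u (gmul c h (Defs.expe i s))) (u' h).

Lemma dX_Xd i u u' : dX i u u' -> Xd c u i = u'.
Proof.
by move=> du; apply/funext => h; rewrite /Xd derive1E; have [_ ->] := du h.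
Qed.

Lemma dX_Xable i u u' h : dX i u u' -> Xable c u i h.
Proof. by move=> du; have [] := du h. Qed.

(** The curve through [h] at time [s] is the curve issuing from [h exp(s e_i)], so differentiability
    at time [0] from every base point gives it at all times. *)
Lemma dX_at i u u' h (s : R) : dX i u u' ->
  is_derive s 1 (fun s => u (gmul c h (Defs.expe i s))) (u' (gmul c h (Defs.expe i s))).
Proof.
move=> du; apply: is_derive_eps => e e0.
have [d d0 hd] := is_derive_epsP (du (gmul c h (Defs.expe i s))) e0.
exists d => // x /hd; rewrite add0r !expeD addr0.
by [].
Qed.

Lemma dX_cst i a : dX i (fun=> a) (fun=> 0).
Proof. by move=> h; exact: is_derive_cst. Qed.

Lemma dX_affine i u u' : (forall h s, u (gmul c h (Defs.expe i s)) = u h + s * u' h) ->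
  dX i u u'.
Proof.
move=> uE h; apply: (@is_derive_quad _ _ _ 0) => s _.
rewrite !uE [X in `|X|](_ : _ = 0) ?normr0 ?mul0r//.
by ring.
Qed.

Lemma dX_z i j : dX i (fun h => h.1 0 j) (fun=> (j == i)%:R).
Proof. by apply: dX_affine => h s; exact: curve_z. Qed.

Lemma dX_t i r : dX i (fun h => h.2 0 r) (fun h => 2^-1 * cz r h.1 i).
Proof. by apply: dX_affine => h s; exact: curve_t. Qed.

Lemma dX_cz i r j : dX i (fun h => cz r h.1 j) (fun=> c r i j).
Proof. by apply: dX_affine => h s; exact: curve_cz. Qed.

Lemma dXD i u u' v v' : dX i u u' -> dX i v v' ->
  dX i (fun h => u h + v h) (fun h => u' h + v' h).
Proof. by move=> du dv h; have := is_deriveD (du h) (dv h). Qed.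

Lemma dXM i u u' v v' : dX i u u' -> dX i v v' ->
  dX i (fun h => u h * v h) (fun h => u h * v' h + v h * u' h).
Proof.
by move=> du dv h; have := is_deriveM (du h) (dv h); rewrite !expe0.
Qed.

Lemma dX_sum i n (u u' : 'I_n -> G -> R) : (forall j, dX i (u j) (u' j)) ->
  dX i (fun h => \sum_j u j h) (fun h => \sum_j u' j h).
Proof.
elim: n u u' => [|n IH] u u' du.
  move=> h; under eq_fun do rewrite big_ord0; rewrite big_ord0.
  exact: is_derive_cst.
have := dXD (du ord0) (IH _ _ (fun j => du (lift ord0 j))).
rewrite /dX => H h; have := H h.
by under [in X in _ -> X]eq_fun do rewrite big_ord_recl; rewrite big_ord_recl.
Qed.

Lemma dX_comp i u u' f (df : R -> R) : dX i u u' ->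
  (forall h, is_derive (u h) 1 f (df (u h))) ->
  dX i (fun h => f (u h)) (fun h => u' h * df (u h)).
Proof.
move=> du fd h.
have fd0 : is_derive (u (gmul c h (Defs.expe i 0))) 1 f (df (u h)) by rewrite expe0; exact: fd.
have := @is_derive1_comp _ f (fun s => u (gmul c h (Defs.expe i s))) 0 _ _ fd0 (du h).
by rewrite mulrC.
Qed.

Lemma dX_eq i u u' v' : dX i u u' -> u' =1 v' -> dX i u v'.
Proof. by move=> du /funext <-. Qed.

Definition W h : R := sqn R h.1 ^+ 2 + 16 * sqn R h.2.

Definition XW (i : 'I_m) h : R :=
  4 * sqn R h.1 * h.1 0 i + 16 * \sum_r h.2 0 r * cz r h.1 i.

(** The value of [X_i X_j W]. The terms in [c r i j] are its antisymmetric part, coming from the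
    commutator of [X_i] and [X_j]; they cancel against symmetric coefficients. *)
Definition XXW (i j : 'I_m) h : R :=
  8 * (h.1 0 i * h.1 0 j) + 4 * sqn R h.1 * (j == i)%:R +
  16 * \sum_r (2^-1 * (cz r h.1 i * cz r h.1 j) + h.2 0 r * c r i j).

Lemma sqn_ge0 n (v : 'rV[R]_n) : 0 <= sqn R v.
Proof. by apply: sumr_ge0 => i _; exact: sqr_ge0. Qed.

Lemma W_ge0 h : 0 <= W h.
Proof. by rewrite addr_ge0 ?sqr_ge0// mulr_ge0// sqn_ge0. Qed.

Lemma dX_sqn1 i : dX i (fun h => sqn R h.1) (fun h => 2 * h.1 0 i).
Proof.
apply: (dX_eq (dX_sum (fun j => dXM (dX_z i j) (dX_z i j)))) => h /=.
rewrite (bigD1 i)//= big1 ?addr0 ?eqxx; first by rewrite !mulr1; ring.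
by move=> j /negbTE ->; rewrite !mulr0 addr0.
Qed.

Lemma dX_sqn2 i : dX i (fun h => sqn R h.2) (fun h => \sum_r h.2 0 r * cz r h.1 i).
Proof.
apply: (dX_eq (dX_sum (fun j => dXM (dX_t i j) (dX_t i j)))) => h /=.
by apply: eq_bigr => r _; field.
Qed.

Lemma dX_W i : dX i W (XW i).
Proof.
apply: (dX_eq (dXD (dXM (dX_sqn1 i) (dX_sqn1 i)) (dXM (dX_cst i 16) (dX_sqn2 i)))).
by move=> h /=; rewrite /XW; ring.
Qed.

Lemma dX_XW i j : dX i (XW j) (XXW i j).
Proof.
apply: (dX_eq (dXD (dXM (dXM (dX_cst i 4) (dX_sqn1 i)) (dX_z i j))
  (dXM (dX_cst i 16) (dX_sum (fun r => dXM (dX_t i r) (dX_cz i r j)))))).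
move=> h /=; rewrite /XXW mulr0 !addr0.
have -> : \sum_r (h.2 0 r * c r i j + cz r h.1 j * (2^-1 * cz r h.1 i)) =
  \sum_r (2^-1 * (cz r h.1 i * cz r h.1 j) + h.2 0 r * c r i j).
  by apply: eq_bigr => r _; ring.
by ring.
Qed.

Variable e : R.
Hypothesis e0 : 0 < e.

(** An algebra stable under every [X_i] and containing the regularised kernels. Local boundedness
    and continuity follow by one induction, and so hold at once for derivatives of all orders. *)
Inductive smooth : (G -> R) -> Prop :=
| smooth_cst a : smooth (fun=> a)
| smooth_z i : smooth (fun h => h.1 0 i)
| smooth_t r : smooth (fun h => h.2 0 r)
| smoothD u v : smooth u -> smooth v -> smooth (fun h => u h + v h)
| smoothM u v : smooth u -> smooth v -> smooth (fun h => u h * v h)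
| smooth_powR b : smooth (fun h => (W h + e) `^ b)
| smooth_ln : smooth (fun h => ln (W h + e)).

Lemma smooth_sum n (u : 'I_n -> G -> R) : (forall j, smooth (u j)) ->
  smooth (fun h => \sum_j u j h).
Proof.
elim: n u => [|n IH] u su.
  by under eq_fun do rewrite big_ord0; exact: smooth_cst.
by under eq_fun do rewrite big_ord_recl; apply: smoothD => //; exact: IH.
Qed.

Lemma smooth_cz r i : smooth (fun h => cz r h.1 i).
Proof. by apply: smooth_sum => j; apply: smoothM; [exact: smooth_z|exact: smooth_cst]. Qed.

Lemma smooth_XW i : smooth (XW i).
Proof.
apply: smoothD; apply: smoothM.
- apply: smoothM; first exact: smooth_cst.
  by apply: smooth_sum => j; apply: smoothM; exact: smooth_z.
- exact: smooth_z.
- exact: smooth_cst.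
- apply: smooth_sum => r; apply: smoothM; [exact: smooth_t|exact: smooth_cz].
Qed.

Lemma We_gt0 h : 0 < W h + e.
Proof. by rewrite ltr_wpDl// W_ge0. Qed.

Lemma dX_We i : dX i (fun h => W h + e) (XW i).
Proof. by apply: (dX_eq (dXD (dX_W i) (dX_cst i e))) => h; rewrite /= addr0. Qed.

Lemma dX_powR i b :
  dX i (fun h => (W h + e) `^ b) (fun h => XW i h * (b * (W h + e) `^ (b - 1))).
Proof.
by apply: (dX_comp (f := fun x => x `^ b) (df := fun x => b * x `^ (b - 1)) (dX_We i))
  => h; apply: is_derive1_powR; exact: We_gt0.
Qed.

Lemma dX_ln i : dX i (fun h => ln (W h + e)) (fun h => XW i h * (W h + e) `^ (-1)).
Proof.
have H := @dX_comp i _ _ (@ln R) (fun x => x^-1) (dX_We i).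
apply: (dX_eq (H _)) => h; first exact/is_derive1_ln/We_gt0.
by rewrite /= powR_inv1// ltW// We_gt0.
Qed.

Lemma smooth_dX i u : smooth u -> exists2 u', smooth u' & dX i u u'.
Proof.
elim=> [a|j|r|{}u v su [u' su' du] sv [v' sv' dv]|{}u v su [u' su' du] sv [v' sv' dv]|b|].
- by exists (fun=> 0); [exact: smooth_cst|exact: dX_cst].
- by exists (fun=> (j == i)%:R); [exact: smooth_cst|exact: dX_z].
- exists (fun h => 2^-1 * cz r h.1 i); last exact: dX_t.
  by apply: smoothM; [exact: smooth_cst|exact: smooth_cz].
- by exists (fun h => u' h + v' h); [exact: smoothD|exact: dXD].
- exists (fun h => u h * v' h + v h * u' h); last exact: dXM.
  by apply: smoothD; exact: smoothM.
- exists (fun h => XW i h * (b * (W h + e) `^ (b - 1))); last exact: dX_powR.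
  apply: smoothM; first exact: smooth_XW.
  by apply: smoothM; [exact: smooth_cst|exact: smooth_powR].
- exists (fun h => XW i h * (W h + e) `^ (-1)); last exact: dX_ln.
  by apply: smoothM; [exact: smooth_XW|exact: smooth_powR].
Qed.

Definition inbox (B : R) h :=
  (forall i, `|h.1 0 i| <= B) /\ (forall r, `|h.2 0 r| <= B).

Definition Wmax (B : R) : R := (m%:R * B ^+ 2) ^+ 2 + 16 * (k%:R * B ^+ 2).

Lemma sqn_le n (v : 'rV[R]_n) B : (forall i, `|v 0 i| <= B) -> sqn R v <= n%:R * B ^+ 2.
Proof.
move=> vB; rewrite mulr_natl -[X in _ <= _ *+ X]card_ord -sumr_const.
apply: ler_sum => i _; rewrite -[v 0 i ^+ 2]real_normK ?num_real//.
by rewrite lerXn2r ?nnegrE//; exact: le_trans (vB i).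
Qed.

Lemma W_le B h : inbox B h -> W h <= Wmax B.
Proof.
move=> [h1 h2]; apply: lerD; last by rewrite ler_pM2l//; exact: sqn_le.
apply: lerXn2r; rewrite ?nnegrE ?sqn_ge0//; last exact: sqn_le.
by apply: mulr_ge0 => //; exact: sqr_ge0.
Qed.

Lemma smooth_bounded u : smooth u -> forall B, exists2 C, 0 <= C &
  forall h, inbox B h -> `|u h| <= C.
Proof.
elim=> [a|j|r|{}u v su IHu sv IHv|{}u v su IHu sv IHv|b|] B.
- by exists `|a|.
- by exists `|B| => // h [hB _]; apply: le_trans (hB j) _; exact: ler_norm.
- by exists `|B| => // h [_ hB]; apply: le_trans (hB r) _; exact: ler_norm.
- have [C C0 uC] := IHu B; have [C' C'0 vC] := IHv B.
  exists (C + C'); first exact: addr_ge0.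
  by move=> h hB; apply: le_trans (ler_normD _ _) _; apply: lerD; [exact: uC|exact: vC].
- have [C C0 uC] := IHu B; have [C' C'0 vC] := IHv B.
  exists (C * C'); first exact: mulr_ge0.
  by move=> h hB; rewrite normrM ler_pM//; [exact: uC|exact: vC].
(* As [W + e] lies between [e] and [Wmax B + e], one of the two summands bounds the power, according
   to the sign of [b]. *)
- exists (e `^ b + (Wmax B + e) `^ b); first by rewrite addr_ge0 ?powR_ge0.
  move=> h /W_le hB; rewrite ger0_norm ?powR_ge0//.
  have eh : e <= W h + e by rewrite lerDr W_ge0.
  have [b0|b0] := leP 0 b.
    rewrite ler_wpDl ?powR_ge0// ge0_ler_powR ?nnegrE ?lerD2r//.
      by rewrite ltW// We_gt0.
    by rewrite (le_trans (ltW (We_gt0 h)))// lerD2r.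
  rewrite ler_wpDr ?powR_ge0// -[b]opprK !(powRN _ (- b)).
  have [[p q] b0'] := (ltW (We_gt0 h), ltW e0, ltW b0).
  by rewrite lef_pV2 ?posrE ?powR_gt0 ?We_gt0// ge0_ler_powR ?nnegrE ?oppr_ge0.
- exists (`|ln e| + `|ln (Wmax B + e)|); first by rewrite addr_ge0.
  move=> h /W_le hB.
  have eh : e <= W h + e by rewrite lerDr W_ge0.
  have h1 : ln e <= ln (W h + e) by rewrite ler_ln ?posrE ?We_gt0.
  have h2 : ln (W h + e) <= ln (Wmax B + e).
    by rewrite ler_ln ?posrE ?We_gt0// ?lerD2r// (lt_le_trans (We_gt0 h))// lerD2r.
  rewrite ler_norml; apply/andP; split.
    rewrite lerNl (le_trans (_ : _ <= - ln e)) ?lerN2//.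
    by rewrite -normrN (le_trans (ler_norm _))// lerDl.
  by rewrite (le_trans h2)// (le_trans (ler_norm _))// lerDr.
Qed.

Lemma smooth_cvg u : smooth u -> forall (hn : nat -> G) h,
  (forall i, (fun n => (hn n).1 0 i) @ \oo --> h.1 0 i) ->
  (forall r, (fun n => (hn n).2 0 r) @ \oo --> h.2 0 r) ->
  (u \o hn) @ \oo --> u h.
Proof.
move=> su hn h h1 h2.
have cs n (v : nat -> 'rV[R]_n) (w : 'rV[R]_n) : (forall i, (fun n => v n 0 i) @ \oo --> w 0 i) ->
    (fun n => sqn R (v n)) @ \oo --> sqn R w.
  move=> vw; rewrite /sqn; under eq_fun do under eq_bigr do rewrite expr2.
  under eq_bigr do rewrite expr2.
  by apply: cvg_big => [|i _]; [exact: add_continuous|apply: cvgM].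
have cW : (fun n => W (hn n) + e) @ \oo --> W h + e.
  apply: cvgD; last exact: cvg_cst.
  apply: cvgD; last by apply: cvgMr; exact: cs.
  by under eq_fun do rewrite expr2; rewrite expr2; apply: cvgM; exact: cs.
elim: su => [a|j|r|{}u v su IHu sv IHv|{}u v su IHu sv IHv|b|] //=.
- exact: cvg_cst.
- exact: h1.
- exact: h2.
- exact: cvgD.
- exact: cvgM.
- have H : x `^ b @[x --> W h + e] --> (W h + e) `^ b.
    exact: (is_derive_cvg_self (is_derive1_powR b (We_gt0 h))).
  exact: (cvg_comp (fun n => W (hn n) + e) (fun x => x `^ b) cW H).
- have H : ln x @[x --> W h + e] --> ln (W h + e).
    exact: (is_derive_cvg_self (is_derive1_ln (We_gt0 h))).
  exact: (cvg_comp (fun n => W (hn n) + e) (@ln R) cW H).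
Qed.

End group.

(** * Horizontal Hessians on groups of Heisenberg type *)

Section dot.
Context {R : realType} {n : nat}.
Implicit Types (u v w : 'rV[R]_n).
Local Notation sqn := (Defs.sqn R).
Local Notation dotr := (Defs.dotr R).

Lemma sqnE v : sqn v = dotr v v.
Proof. by apply: eq_bigr => i _; rewrite expr2. Qed.

Lemma dotC u v : dotr u v = dotr v u.
Proof. by apply: eq_bigr => i _; rewrite mulrC. Qed.

Lemma dotDl u v w : dotr (u + v) w = dotr u w + dotr v w.
Proof. by rewrite -big_split; apply: eq_bigr => i _ /=; rewrite rowDE mulrDl. Qed.

Lemma dotZl a u w : dotr (a *: u) w = a * dotr u w.
Proof. by rewrite mulr_sumr; apply: eq_bigr => i _; rewrite rowZE mulrA. Qed.

Lemma sqn_lin x y u v :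
  sqn (x *: u + y *: v) = x ^+ 2 * sqn u + 2 * x * y * dotr u v + y ^+ 2 * sqn v.
Proof.
rewrite !sqnE dotDl !dotZl ![dotr _ (_ + _)]dotC !dotDl !dotZl [dotr v u]dotC.
by ring.
Qed.

Lemma dot_le u v : dotr u v ^+ 2 <= sqn u * sqn v.
Proof.
have H x y : 0 <= x ^+ 2 * sqn u + 2 * x * y * dotr u v + y ^+ 2 * sqn v.
  by rewrite -sqn_lin sqn_ge0.
(* With [a = |u|^2], [d = |v|^2], [b = <u, v>] these read [a (a d - b^2) >= 0] and
   [d (a d - b^2) >= 0]. If [a = d = 0], the choices [(1, 1)] and [(1, -1)] force [b = 0]. *)
have := H (dotr u v) (- sqn u); have := H (sqn v) (- dotr u v).
have := H 1 1; have := H 1 (-1).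
have := sqn_ge0 u; have := sqn_ge0 v.
set a := sqn u; set b := dotr u v; set d := sqn v => d0 a0 h1 h2 h3 h4.
have [a1|a1] := ltP 0 a.
  rewrite -subr_ge0 -(pmulr_rge0 _ a1).
  by apply: le_trans h4 _; rewrite le_eqVlt; apply/orP; left; apply/eqP; ring.
have [d1|d1] := ltP 0 d.
  rewrite -subr_ge0 -(pmulr_rge0 _ d1).
  by apply: le_trans h3 _; rewrite le_eqVlt; apply/orP; left; apply/eqP; ring.
have -> : a = 0 by apply/eqP; rewrite eq_le a0 a1.
have -> : b = 0 by lra.
by rewrite mul0r expr0n.
Qed.

End dot.

Section htype.
Context {R : realType} {m k : nat} (c : 'I_k -> 'M[R]_m).
Hypothesis csk : bracket_skew c.
Hypothesis cH : Htype c.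
Notation G := (G R m k).
Implicit Types (g h : G) (z v : 'rV[R]_m) (t : 'rV[R]_k).
Local Notation sqn := (Defs.sqn R).
Local Notation dotr := (Defs.dotr R).

Lemma JmxZ a t : Jmx c (a *: t) = a *: Jmx c t.
Proof. by rewrite scaler_sumr; apply: eq_bigr => r _; rewrite rowZE scalerA. Qed.

Lemma Jmx_delta r : Jmx c (delta_mx 0 r) = c r.
Proof.
rewrite /Jmx (bigD1 r)//= big1 ?addr0; first by rewrite mxE !eqxx scale1r.
by move=> s /negbTE sr; rewrite mxE sr andbF scale0r.
Qed.

(** The defining identity for unit [t], extended by homogeneity; [t = 0] is treated apart. *)
Lemma JJT t : Jmx c t *m (Jmx c t)^T = (sqn t)%:M.
Proof.
have [t0|t0] := eqVneq (sqn t) 0.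
  have -> : t = 0.
    apply/rowP => r; rewrite mxE; apply/eqP; rewrite -sqrf_eq0; apply/eqP.
    by move: t0 => /psumr_eq0P; apply => // i _; exact: sqr_ge0.
  have -> : Jmx c 0 = 0 by apply: big1 => r _; rewrite mxE scale0r.
  rewrite mul0mx [sqn 0]big1 ?raddf0// => r _.
  by rewrite mxE expr0n.
have tp : 0 < sqn t by rewrite lt_neqAle eq_sym t0 sqn_ge0.
pose a := Num.sqrt (sqn t).
have a0 : a != 0 by rewrite gt_eqF// sqrtr_gt0.
have aE : a ^+ 2 = sqn t by rewrite sqr_sqrtr// ltW.
have tE : t = a *: (a^-1 *: t) by rewrite scalerA mulfV// scale1r.
have s1 : sqn (a^-1 *: t) = 1.
  rewrite sqnE dotZl dotC dotZl -sqnE -aE mulrA -expr2 exprVn mulVf//.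
  by rewrite expf_neq0.
rewrite {1 2}tE JmxZ linearZ /= -scalemxAl -scalemxAr cH// scalerA -expr2 aE.
by rewrite scale_scalar_mx mulr1.
Qed.

Lemma sqn_mx n (v : 'rV[R]_n) : sqn v = (v *m v^T) 0 0.
Proof. by rewrite mxE; apply: eq_bigr => i _; rewrite mxE expr2. Qed.

Lemma zJE z t i : (z *m Jmx c t) 0 i = \sum_r t 0 r * cz c r z i.
Proof.
rewrite /Jmx mulmx_sumr summxE; apply: eq_bigr => r _.
by rewrite -scalemxAr rowZE czE.
Qed.

Lemma sqn_zJ z t : sqn (z *m Jmx c t) = sqn t * sqn z.
Proof.
rewrite sqn_mx trmx_mul mulmxA -[_ *m _ *m (Jmx c t)^T]mulmxA JJT.
by rewrite mul_mx_scalar -scalemxAl mxE -sqn_mx.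
Qed.

Lemma sqn_cz z r : \sum_i cz c r z i ^+ 2 = sqn z.
Proof.
have := sqn_zJ z (delta_mx 0 r); rewrite Jmx_delta.
have -> : sqn (delta_mx 0 r : 'rV[R]_k) = 1.
  rewrite /Defs.sqn (bigD1 r)//= big1 ?addr0; first by rewrite mxE !eqxx expr1n.
  by move=> s /negbTE sr; rewrite mxE sr andbF expr0n.
by rewrite mul1r => <-; apply: eq_bigr => i _; rewrite czE.
Qed.

Lemma bracketC z v : bracket c z v = - bracket c v z.
Proof.
apply/rowP => r; rewrite rowNE !bracketE -sumrN.
under eq_bigr => i _ do rewrite mulr_suml.
rewrite exchange_big /=; apply: eq_bigr => i _; rewrite mulr_suml -sumrN.
by apply: eq_bigr => j _; rewrite (skewE csk r j i); ring.
Qed.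

Lemma bracket_self z : bracket c z z = 0.
Proof.
apply/rowP => r; rewrite [RHS]mxE.
have := congr1 (fun w : 'rV[R]_k => w 0 r) (bracketC z z); rewrite rowNE => e; lra.
Qed.

Lemma dot_zJ z t v : dotr (z *m Jmx c t) v = dotr t (bracket c z v).
Proof.
rewrite /Defs.dotr; under eq_bigr => i _ do rewrite zJE mulr_suml.
rewrite exchange_big /=; apply: eq_bigr => r _; rewrite bracketE mulr_sumr.
by apply: eq_bigr => i _; rewrite mulrA.
Qed.

Lemma dot_zJz z t : dotr z (z *m Jmx c t) = 0.
Proof.
by rewrite dotC dot_zJ bracket_self /Defs.dotr big1// => i _; rewrite mxE mulr0.
Qed.

(** The sum of the squared inner products of [v] with [z] and with the [J(eps_r) z], since the
    latter inner products are the coordinates of [[z, v]]. *)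
Definition bessel z v : R := dotr z v ^+ 2 + sqn (bracket c z v).

Lemma bessel_ge0 z v : 0 <= bessel z v.
Proof. by rewrite addr_ge0 ?sqr_ge0 ?sqn_ge0. Qed.

(* [z] and the [J_s z] are pairwise orthogonal with the same norm as [z]; testing [v] against
   the combination [w] of them with coefficients the inner products with [v] gives
   [<w, v> = bessel z v] and [|w|^2 = bessel z v * |z|^2]. *)
Lemma bessel_le z v : bessel z v <= sqn z * sqn v.
Proof.
pose b := bracket c z v; pose a := dotr z v.
pose w := a *: z + 1 *: (z *m Jmx c b).
have wv : dotr w v = bessel z v.
  by rewrite dotDl !dotZl dot_zJ mul1r -/b -sqnE -expr2.
have ww : sqn w = bessel z v * sqn z.
  by rewrite sqn_lin dot_zJz sqn_zJ; rewrite /bessel -/a -/b; ring.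
have := dot_le w v; rewrite wv ww -mulrA expr2.
have := bessel_ge0 z v; rewrite le_eqVlt => /orP[/eqP <- _|A0].
  by rewrite mulr_ge0 ?sqn_ge0.
by rewrite ler_pM2l.
Qed.

Lemma XWE h i : XW c i h = (4 * sqn h.1 *: h.1 + 16 *: (h.1 *m Jmx c h.2)) 0 i.
Proof. by rewrite rowDE !rowZE zJE. Qed.

(** The cross term drops because [J(t) z] is orthogonal to [z], and [|J(t) z| = |t| |z|] rebuilds
    [W]. Away from the origin this is the identity [|XN| = |z| / N]. *)
Lemma sum_XW2 h : \sum_i XW c i h ^+ 2 = 16 * sqn h.1 * W h.
Proof.
under eq_bigr do rewrite XWE; rewrite -/(Defs.sqn R _) sqn_lin dot_zJz sqn_zJ /W.
by ring.
Qed.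

Lemma sum_vXW h v : \sum_i v 0 i * XW c i h =
  4 * sqn h.1 * dotr h.1 v + 16 * dotr h.2 (bracket c h.1 v).
Proof.
under eq_bigr do rewrite XWE; rewrite -/(Defs.dotr R _ _) dotC dotDl !dotZl.
by rewrite dot_zJ.
Qed.

(** Cauchy-Schwarz for the pairs [(|z|^2, 4 t)] and [(<z, v>, [z, v])], whose inner product is a
    quarter of the left-hand sum. *)
Lemma sum_vXW2_le h v : (\sum_i v 0 i * XW c i h) ^+ 2 <= 16 * W h * bessel h.1 v.
Proof.
rewrite sum_vXW /bessel /W.
have := dot_le h.2 (bracket c h.1 v).
have := sqn_ge0 h.2; have := sqn_ge0 (bracket c h.1 v); have := sqn_ge0 h.1.
set S := sqn h.1; set T := sqn h.2; set b := sqn _; set a := dotr h.1 v; set x := dotr h.2 _.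
move=> S0 b0 T0 xb.
have P0 : 0 <= S ^+ 2 * b + 16 * a ^+ 2 * T.
  by rewrite addr_ge0// mulr_ge0 ?sqr_ge0// mulr_ge0// sqr_ge0.
have key : 8 * (S * a * x) <= S ^+ 2 * b + 16 * a ^+ 2 * T.
  have [|n0] := leP (S * a * x) 0.
    move=> n0; apply: le_trans (_ : 0 <= _); first lra.
    by [].
  rewrite -ler_sqr ?nnegrE; [|lra|by []].
  have h1 : (S * a) ^+ 2 * x ^+ 2 <= (S * a) ^+ 2 * (T * b) by rewrite ler_wpM2l ?sqr_ge0.
  have := sqr_ge0 (S ^+ 2 * b - 16 * a ^+ 2 * T); lra.
lra.
Qed.

(** The identity matrix contributes [m] and the orthogonality of each [J(eps_r)] contributes [2] for
    every [r]: together they form [Q = m + 2k]. *)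
Lemma sum_XXW h : \sum_i XXW c i i h = 4 * ((m + 2 * k)%:R + 2) * sqn h.1.
Proof.
have E i : XXW c i i h = 8 * (h.1 0 i) ^+ 2 + 4 * sqn h.1 +
    8 * \sum_r cz c r h.1 i ^+ 2.
  rewrite /XXW eqxx mulr1 expr2; congr (_ + _ + _).
  rewrite (_ : \sum_r _ = 2^-1 * \sum_r cz c r h.1 i ^+ 2); first by field.
  rewrite mulr_sumr; apply: eq_bigr => r _.
  have -> : c r i i = 0 by have := skewE csk r i i => e; lra.
  by rewrite mulr0 addr0 expr2.
under eq_bigr do rewrite E.
rewrite !big_split/= -!mulr_sumr sumr_const card_ord exchange_big/=.
under [X in _ + 8 * X]eq_bigr do rewrite sqn_cz.
have -> : \sum_(i < m) h.1 0 i ^+ 2 = sqn h.1 by [].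
rewrite sumr_const card_ord natrD natrM -[_ *+ m]mulr_natl -[_ *+ k]mulr_natl.
by ring.
Qed.

Lemma sum_vvXXW h v : \sum_i \sum_j v 0 i * v 0 j * XXW c i j h =
  4 * sqn h.1 * sqn v + 8 * bessel h.1 v.
Proof.
have E i : \sum_j v 0 i * v 0 j * XXW c i j h =
   8 * (h.1 0 i * v 0 i) * dotr h.1 v + 4 * sqn h.1 * v 0 i ^+ 2 +
   8 * (\sum_r (cz c r h.1 i * v 0 i) * bracket c h.1 v 0 r) +
   16 * (\sum_r h.2 0 r * (\sum_j (v 0 i * c r i j) * v 0 j)).
  under eq_bigr => j _ do rewrite /XXW big_split/= -!mulr_sumr !mulrDr.
  rewrite !big_split/= addrA; congr (_ + _ + _ + _).
  - by rewrite /Defs.dotr mulr_sumr; apply: eq_bigr => j _; ring.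
  - rewrite (bigD1 i)//= big1 ?addr0 ?eqxx; first by rewrite mulr1; ring.
    by move=> j /negbTE ->; rewrite !mulr0.
  - under eq_bigr => j _ do rewrite mulrCA mulrA mulrCA mulrA !mulr_sumr.
    rewrite exchange_big mulr_sumr; apply: eq_bigr => r _ /=; rewrite bracketE.
    by rewrite !mulr_sumr; apply: eq_bigr => j _; field.
  - under eq_bigr => j _ do rewrite !mulr_sumr.
    rewrite exchange_big mulr_sumr; apply: eq_bigr => r _ /=.
    by rewrite !mulr_sumr; apply: eq_bigr => j _; ring.
under eq_bigr => i _ do rewrite E.
rewrite !big_split/= /bessel mulrDr [LHS](_ : _ =
  8 * dotr h.1 v ^+ 2 + 4 * sqn h.1 * sqn v + 8 * sqn (bracket c h.1 v) + 0); first by ring.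
congr (_ + _ + _ + _).
- by rewrite -mulr_suml -mulr_sumr -mulrA -expr2.
- by rewrite -mulr_sumr.
- rewrite -mulr_sumr exchange_big/=; congr (_ * _); apply: eq_bigr => r _.
  by rewrite -mulr_suml -bracketE -expr2.
- rewrite -mulr_sumr exchange_big big1 ?mulr0// => r _ /=.
  rewrite -mulr_sumr exchange_big/=.
  under eq_bigr => j _ do rewrite -mulr_suml.
  by rewrite -bracketE bracket_self mxE mulr0.
Qed.

Lemma sqr_le_sqn n (v : 'rV[R]_n) i : v 0 i ^+ 2 <= sqn v.
Proof.
by rewrite /Defs.sqn (bigD1 i)//= lerDl; apply: sumr_ge0 => j _; exact: sqr_ge0.
Qed.

Lemma le_sqrtW h x : 0 <= x -> x ^+ 2 <= W h -> x <= W h `^ 2^-1.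
Proof.
move=> x0 xW; rewrite powR12_sqrt ?W_ge0// -(ler_sqr _ _) ?nnegrE ?sqrtr_ge0//.
by rewrite sqr_sqrtr// W_ge0.
Qed.

Lemma sqn1_leW h : sqn h.1 <= W h `^ 2^-1.
Proof.
apply: le_sqrtW; first exact: sqn_ge0.
by rewrite lerDl mulr_ge0// sqn_ge0.
Qed.

(** Under the dilations [(z, t) -> (l z, l^2 t)] the function [W] has degree 4, so [X_i W] has
    degree 3 and [X_i X_j W] has degree 2, whence the exponents [3/4] here and [1/2] in [XXW_le]. *)
Lemma XW_le h i : `|XW c i h| <= 4 * W h `^ (3 / 4).
Proof.
rewrite -(ler_sqr _ _) ?nnegrE ?mulr_ge0 ?powR_ge0// real_normK ?num_real//.
have h1 : XW c i h ^+ 2 <= 16 * sqn h.1 * W h.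
  rewrite -sum_XW2 (bigD1 i)//= lerDl; apply: sumr_ge0 => j _; exact: sqr_ge0.
apply: le_trans h1 _; rewrite exprMn.
have -> : (W h `^ (3 / 4)) ^+ 2 = W h `^ 2^-1 * W h.
  rewrite -powR_mulrn ?powR_ge0// -powRrM -{3}(powRr1 (W_ge0 h)) -powRD; first by congr (_ `^ _); lra.
  by apply/implyP => /eqP; lra.
by rewrite -mulrA (_ : 4 ^+ 2 = 16); [rewrite ler_pM2l// ler_wpM2r ?W_ge0// sqn1_leW|ring].
Qed.

Lemma J_le t i j : (Jmx c t i j) ^+ 2 <= sqn t.
Proof.
have := JJT t => /matrixP/(_ i i); rewrite !mxE eqxx mulr1n => <-.
rewrite (bigD1 j)//= mxE -expr2 lerDl; apply: sumr_ge0 => l _.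
by rewrite mxE -expr2 sqr_ge0.
Qed.

Lemma XXW_le h i j : `|XXW c i j h| <= (16 + 8 * k%:R) * W h `^ 2^-1.
Proof.
have P (x y s : R) : x ^+ 2 <= s -> y ^+ 2 <= s -> `|x * y| <= s.
  move=> xs ys; rewrite ler_norml; apply/andP; split.
    have := sqr_ge0 (x + y); nra.
  have := sqr_ge0 (x - y); nra.
have S := sqn1_leW h; set w := W h `^ 2^-1 in S *.
have w0 : 0 <= w by exact: powR_ge0.
have h1 : `|8 * (h.1 0 i * h.1 0 j)| <= 8 * w.
  rewrite normrM ger0_norm// ler_pM2l//; apply: le_trans S.
  by apply: P; exact: sqr_le_sqn.
have h2 : `|4 * sqn h.1 * (j == i)%:R| <= 4 * w.
  rewrite !normrM ger0_norm// -mulrA ler_pM2l// ger0_norm ?sqn_ge0//.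
  apply: le_trans S; case: (j == i); rewrite ?normr1 ?mulr1// normr0 mulr0.
  exact: sqn_ge0.
have h3 : `|\sum_r 2^-1 * (cz c r h.1 i * cz c r h.1 j)| <= 2^-1 * (k%:R * w).
  apply: le_trans (ler_norm_sum _ _ _) _.
  have -> : k%:R * w = \sum_(r < k) w by rewrite sumr_const card_ord mulr_natl.
  rewrite mulr_sumr; apply: ler_sum => r _.
  rewrite normrM ger0_norm// ler_pM2l//; apply: le_trans S; apply: P.
    by rewrite -(sqn_cz h.1 r) (bigD1 i)//= lerDl; apply: sumr_ge0 => l _; exact: sqr_ge0.
  by rewrite -(sqn_cz h.1 r) (bigD1 j)//= lerDl; apply: sumr_ge0 => l _; exact: sqr_ge0.
(* This sum is an entry of [J(t)], bounded by [|t|], and [16 |t|^2 <= W]. *)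
have h4 : `|\sum_r h.2 0 r * c r i j| <= 4^-1 * w.
  have -> : \sum_r h.2 0 r * c r i j = Jmx c h.2 i j.
    by rewrite /Jmx summxE; apply: eq_bigr => r _; rewrite mxE.
  rewrite ler_pdivlMl//; apply: le_sqrtW; first by rewrite mulr_ge0.
  rewrite exprMn real_normK ?num_real// /W.
  have := J_le h.2 i j; have := sqr_ge0 (sqn h.1); lra.
rewrite /XXW big_split/=.
apply: le_trans (ler_normD _ _) _.
apply: le_trans (lerD (ler_normD _ _) (lexx _)) _.
rewrite [`|16 * _|]normrM [`|16|]ger0_norm//.
have := ler_normD (\sum_r 2^-1 * (cz c r h.1 i * cz c r h.1 j)) (\sum_r h.2 0 r * c r i j).
lra.
Qed.

Local Notation Q := ((m + 2 * k)%:R : R).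

(* In terms of [S = |z|^2 |v|^2] and [A = bessel z v <= S], the left-hand side is at least
   [4 w ((S - A) (Q + p - 4 + 4 b) + A (Q - p + 4 b (p - 1)))]. *)
Lemma hess_sum_ge0 h v (p b e : R) : 0 <= e -> 2 <= p ->
  0 <= Q - p + 4 * b * (p - 1) -> 0 <= Q + p - 4 + 4 * b ->
  0 <= (b - 1) * (sqn v * \sum_i XW c i h ^+ 2 + (p - 2) * (\sum_i v 0 i * XW c i h) ^+ 2)
     + (W h + e) * (sqn v * \sum_i XXW c i i h +
                    (p - 2) * \sum_i \sum_j v 0 i * v 0 j * XXW c i j h).
Proof.
move=> e0 p2 c1 c2; rewrite sum_XXW sum_vvXXW sum_XW2.
have := sum_vXW2_le h v; have := bessel_le h.1 v; have := bessel_ge0 h.1 v.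
have := W_ge0 h; have := sqn_ge0 h.1; have := sqn_ge0 v.
set V := (_ ^+ 2); have : 0 <= V by exact: sqr_ge0.
have : 0 <= Q by exact: ler0n.
move: (sqn v) (sqn h.1) (W h) (bessel h.1 v) V Q c1 c2 => N S w A V q c1 c2.
move=> q0 V0 N0 S0 w0 A0 AS VA.
have p20 : 0 <= p - 2 by lra.
have NS : 0 <= S * N by rewrite mulr_ge0.
have we : 0 <= w + e by rewrite addr_ge0.
(* For [b >= 1] all terms are nonnegative. Otherwise the gradient terms carry a negative factor and
   must be bounded above, by [X1]. *)
have [b1|b1] := leP 1 b.
  have b10 : 0 <= b - 1 by lra.
  by repeat (first [done | apply: mulr_ge0 | apply: addr_ge0]).
have X1 : N * (16 * S * w) + (p - 2) * V <= (w + e) * (16 * (S * N + (p - 2) * A)).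
  have : (p - 2) * V <= (p - 2) * (16 * (w + e) * A).
    rewrite ler_wpM2l// (le_trans VA)// -!mulrA ler_pM2l// ler_wpM2r//; lra.
  have : w * (S * N) <= (w + e) * (S * N) by rewrite ler_wpM2r//; lra.
  lra.
have := ler_wpM2l (_ : 0 <= 1 - b) X1.
move=> /(_ ltac:(lra)) X2.
have X3 : 0 <= (w + e) * (4 * ((S * N - A) * (q + p - 4 + 4 * b)
                               + A * (q - p + 4 * b * (p - 1)))).
  by rewrite mulr_ge0// mulr_ge0// addr_ge0 ?mulr_ge0// subr_ge0.
lra.
Qed.

(** The part of [hess_sum_ge0] carrying the factor [p - 2], taken alone. With [S = |z|^2 |v|^2] and
    [A = bessel z v] it is at least [4 (w + e) ((S - A) + A (4 b - 1))] when [b < 1]. *)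
Lemma hess_vv_ge0 h v (b e : R) : 0 <= e -> 1 <= 4 * b ->
  0 <= (b - 1) * (\sum_i v 0 i * XW c i h) ^+ 2
     + (W h + e) * \sum_i \sum_j v 0 i * v 0 j * XXW c i j h.
Proof.
move=> e0 b4; rewrite sum_vvXXW.
have := sum_vXW2_le h v; have := bessel_le h.1 v; have := bessel_ge0 h.1 v.
have := W_ge0 h; have := sqn_ge0 h.1; have := sqn_ge0 v.
set V := (_ ^+ 2); have : 0 <= V by exact: sqr_ge0.
move: (sqn v) (sqn h.1) (W h) (bessel h.1 v) V => N S w A V.
move=> V0 N0 S0 w0 A0 AS VA.
have NS : 0 <= S * N by rewrite mulr_ge0.
have we : 0 <= w + e by rewrite addr_ge0.
have [b1|b1] := leP 1 b.
  have b10 : 0 <= b - 1 by lra.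
  by repeat (first [done | apply: mulr_ge0 | apply: addr_ge0]).
have X1 : V <= (w + e) * (16 * A).
  apply: le_trans VA _; rewrite mulrCA mulrA ler_wpM2r// ler_pM2l//; lra.
have := ler_wpM2l (_ : 0 <= 1 - b) X1.
move=> /(_ ltac:(lra)) X2.
have X3 : 0 <= (w + e) * (4 * ((S * N - A) + A * (4 * b - 1))).
  rewrite mulr_ge0// mulr_ge0// addr_ge0 ?mulr_ge0 ?subr_ge0//.
lra.
Qed.

End htype.

(** * Rate of convergence of the regularised kernels *)

Section rate.
Context {R : realType}.
Implicit Types (x y a b : R).

Lemma powR_lex x y a : 0 < x -> x <= y -> 0 <= a -> x `^ a <= y `^ a.
Proof.
move=> x0 xy a0; apply: ge0_ler_powR => //; rewrite nnegrE ltW//.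
exact: lt_le_trans xy.
Qed.

Lemma powR_gex x y a : 0 < x -> x <= y -> a <= 0 -> y `^ a <= x `^ a.
Proof.
move=> x0 xy a0; have y0 := lt_le_trans x0 xy.
rewrite -[a]opprK (powRN y) (powRN x) lef_pV2 ?posrE ?powR_gt0//.
by rewrite powR_lex// oppr_ge0.
Qed.

Lemma powRDp x a b : 0 < x -> x `^ (a + b) = x `^ a * x `^ b.
Proof. by move=> x0; rewrite powRD// (gt_eqF x0) implybT. Qed.

(* By Cauchy's mean value theorem applied to [psi (w + t)] and [t `^ eta]; the factor
   [(w + t) `^ (b - 1)] is at most [t `^ (eta - 1) * (w + t) `^ (b - eta)]. *)
Lemma rate_le (psi dpsi : R -> R) (A b q gam eta M : R) :
  (forall x, 0 < x -> is_derive x 1 psi (dpsi x)) ->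
  (forall x, 0 < x -> `|dpsi x| <= A * x `^ (b - 1)) ->
  0 <= A -> 0 <= q -> 0 <= gam -> 0 < eta -> eta <= 1 -> 0 <= b + q - eta + gam ->
  forall w e e', 0 < w -> w <= M -> 0 < e' -> e' <= e -> e <= 1 ->
  w `^ q * `|psi (w + e) - psi (w + e')| <=
    A / eta * (M + 1) `^ (b + q - eta + gam) * (w `^ (- gam) * e `^ eta).
Proof.
move=> dpsiE dpsi_le A0 q0 gam0 eta0 eta1 sig0 w e e' w0 wM e'0 e'e e1.
have M0 : 0 <= A / eta * (M + 1) `^ (b + q - eta + gam) * (w `^ (- gam) * e `^ eta).
  by rewrite !mulr_ge0 ?powR_ge0// invr_ge0 ltW.
move: e'e; rewrite le_eqVlt => /orP[/eqP ->|e'e]; first by rewrite subrr normr0 mulr0.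
have dg x : x \in `]e', e[%R -> is_derive x 1 (fun t => t `^ eta) (eta * x `^ (eta - 1)).
  by rewrite in_itv/= => /andP[h _]; apply: is_derive1_powR; exact: lt_trans h.
have dsh x : is_derive x 1 (fun t : R => w + t) 1.
  by have h := @is_deriveD _ _ _ (cst w) id x 1 0 1 _ _; rewrite add0r in h; exact: h.
have df' x : e' <= x -> is_derive x 1 (fun t => psi (w + t)) (dpsi (w + x)).
  move=> h; have x0 : 0 < w + x by rewrite addr_gt0// (lt_le_trans e'0).
  have := @is_derive1_comp _ psi (fun t => w + t) x _ _ (dpsiE _ x0) (dsh x).
  by rewrite mulr1.
have cont (f : R -> R) (df : R -> R) : (forall x, e' <= x -> is_derive x 1 f (df x)) ->
    {within `[e', e], continuous f}.
  move=> fd; apply: continuous_in_subspaceT => x /set_mem /=.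
  by rewrite in_itv/= => /andP[/fd h _]; exact: is_derive_cvg_self h.
have df x : x \in `]e', e[%R -> is_derive x 1 (fun t => psi (w + t)) (dpsi (w + x)).
  by rewrite in_itv/= => /andP[h _]; apply: df'; exact: ltW.
have dg0 x : x \in `]e', e[%R -> eta * x `^ (eta - 1) != 0.
  rewrite in_itv/= => /andP[h _]; rewrite mulf_neq0 ?gt_eqF//.
  by rewrite powR_gt0// (lt_trans e'0).
have [x xI] : exists2 x, x \in `]e', e[%R & dpsi (w + x) / (eta * x `^ (eta - 1)) =
    (psi (w + e) - psi (w + e')) / (e `^ eta - e' `^ eta).
  apply: (@cauchy_MVT _ (fun t => psi (w + t)) (fun x => dpsi (w + x))
    (fun t => t `^ eta) (fun x => eta * x `^ (eta - 1))) => //.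
  - exact: cont df'.
  - apply: (cont _ (fun x => eta * x `^ (eta - 1))) => x h.
    by apply: is_derive1_powR; exact: lt_le_trans h.
have [x0 xe] : 0 < x /\ x < e.
  by move: xI; rewrite in_itv/= => /andP[h1 h2]; rewrite (lt_trans e'0).
have dpos : 0 < e `^ eta - e' `^ eta.
  by rewrite subr_gt0 gt0_ltr_powR ?nnegrE ?ltW// (lt_trans e'0).
move=> /(congr1 ( *%R^~ (e `^ eta - e' `^ eta))).
rewrite divfK ?gt_eqF// => <-.
have wx0 : 0 < w + x by rewrite addr_gt0.
have xp : 0 < x `^ (eta - 1) by rewrite powR_gt0.
rewrite !normrM normfV (gtr0_norm dpos) (gtr0_norm (_ : 0 < eta * _)) ?mulr_gt0//.
have h1 : `|dpsi (w + x)| * w `^ q <=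
    A * (x `^ (eta - 1) * ((M + 1) `^ (b + q - eta + gam) * w `^ (- gam))).
  apply: le_trans (ler_wpM2r (powR_ge0 _ _) (dpsi_le _ wx0)) _.
  rewrite -mulrA ler_wpM2l//.
  set sg := b + q - eta + gam.
  (* Each factor has its own bound: exponent [eta - 1 <= 0] compares with [x], the nonnegative [sg]
     with [M + 1], [- gam] with [w], and [- q] is cancelled by the prefactor of exponent [q]. *)
  have -> : (w + x) `^ (b - 1) = (w + x) `^ (eta - 1) *
      ((w + x) `^ sg * ((w + x) `^ (- gam) * (w + x) `^ (- q))).
    by rewrite -!powRDp//; congr (_ `^ _); rewrite /sg; ring.
  rewrite -mulrA ler_pM ?mulr_ge0 ?powR_ge0//.
    by apply: powR_gex; rewrite ?subr_le0// lerDr ltW.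
  rewrite -mulrA ler_pM ?mulr_ge0 ?powR_ge0//.
    by apply: powR_lex => //; rewrite lerD// (le_trans (ltW xe)).
  have wq : (w + x) `^ (- q) * w `^ q <= 1.
    rewrite powRN mulrC ler_pdivrMr ?powR_gt0// mul1r.
    by apply: powR_lex => //; rewrite lerDl ltW.
  rewrite -mulrA -[leRHS]mulr1 ler_pM ?mulr_ge0 ?powR_ge0//.
  by apply: powR_gex; rewrite ?lerDl ?oppr_le0// ltW.
rewrite mulrC -!mulrA [leLHS]mulrC.
have ee : e `^ eta - e' `^ eta <= e `^ eta by rewrite gerBl powR_ge0.
have -> : (eta * x `^ (eta - 1))^-1 = eta^-1 / x `^ (eta - 1) by rewrite invfM.
have E1 : A * (x `^ (eta - 1) * ((M + 1) `^ (b + q - eta + gam) * w `^ (- gam))) *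
  (eta^-1 / x `^ (eta - 1)) * e `^ eta =
  A * (eta^-1 * ((M + 1) `^ (b + q - eta + gam) * (w `^ (- gam) * e `^ eta))).
  by field; rewrite !gt_eqF.
rewrite -E1.
have I0 : 0 <= eta^-1 / x `^ (eta - 1) by rewrite mulr_ge0 ?invr_ge0 ?powR_ge0 ?ltW.
have h2 := ler_wpM2r I0 h1.
have h3 := ler_pM (mulr_ge0 (mulr_ge0 (normr_ge0 _) (powR_ge0 _ _)) I0) (ltW dpos) h2 ee.
apply: le_trans h3; rewrite le_eqVlt; apply/orP; left; apply/eqP; ring.
Qed.

End rate.

(** * Horizontal derivatives of the regularised kernels *)

Section kernels.
Context {R : realType} {m k : nat} (c : 'I_k -> 'M[R]_m).
Hypothesis csk : bracket_skew c.
Hypothesis cH : Htype c.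
Notation G := (G R m k).
Implicit Types (h : G).

Variables (psi : R -> R) (kap b : R).
Hypothesis psiE : forall x : R, 0 < x -> is_derive x 1 psi (kap * x `^ (b - 1)).

(** The assumption on [psi] covers the power of exponent [b], with [kap = b], and [ln x / 4], with
    [kap = 1/4] and [b = 0]. From the first derivative on, the two kernels have the same form. *)
Definition K (e : R) h : R := psi (W h + e).
Definition XK (e : R) i h : R := kap * ((W h + e) `^ (b - 1) * XW c i h).
Definition XXK (e : R) i j h : R :=
  kap * ((b - 1) * (W h + e) `^ (b - 2) * (XW c i h * XW c j h) +
         (W h + e) `^ (b - 1) * XXW c i j h).

Lemma dX_K e i : 0 < e -> dX c i (K e) (XK e i).
Proof.
move=> e0.
have H := @dX_comp _ _ _ c i _ _ psi (fun x => kap * x `^ (b - 1))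
  (dX_We c e i) (fun h => psiE (We_gt0 e0 h)).
by apply: (dX_eq H) => h; rewrite /XK; ring.
Qed.

Lemma dX_XK e i j : 0 < e -> dX c i (XK e j) (XXK e i j).
Proof.
move=> e0.
have H := dXM (dX_cst c i kap) (dXM (dX_powR c e0 i (b - 1)) (dX_XW c i j)).
apply: (dX_eq H) => h.
rewrite /XXK (_ : b - 1 - 1 = b - 2); first by ring.
by ring.
Qed.

Lemma smooth_XK e i : smooth e (XK e i).
Proof.
apply: smoothM; first exact: smooth_cst.
by apply: smoothM; [exact: smooth_powR|exact: smooth_XW].
Qed.

Variables (gam eta : R).
Hypothesis gam0 : 0 <= gam.
Hypothesis eta0 : 0 < eta.
Hypothesis eta1 : eta <= 1.
Hypothesis bge : 0 <= b - 2^-1 - eta + gam.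

(** [rate_le] is applied with [q = 0], [3/4], [3/2] and [1/2], the weights of [1], [XW], [XW XW] and
    [XXW]. The resulting exponents are [b], [b - 1/4] and, for second derivatives, [b - 1/2]; the
    last is the binding one, which explains [bge]. *)
Lemma kernel_rates B : exists2 C, 0 <= C &
  forall h, inbox B h -> 0 < W h -> forall e e', 0 < e' -> e' <= e -> e <= 1 ->
  [/\ `|K e h - K e' h| <= C * (W h `^ (- gam) * e `^ eta),
      forall i, `|XK e i h - XK e' i h| <= C * (W h `^ (- gam) * e `^ eta) &
      forall i j, `|XXK e i j h - XXK e' i j h| <= C * (W h `^ (- gam) * e `^ eta)].
Proof.
pose M := @Wmax R m k B; have bge' := bge.
have dpow (a x : R) : 0 < x -> is_derive x 1 (fun y => y `^ a) (a * x `^ (a - 1)).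
  by move=> x0; exact: is_derive1_powR.
have dple (a x : R) : 0 < x -> `|a * x `^ (a - 1)| <= `|a| * x `^ (a - 1).
  by move=> x0; rewrite normrM (ger0_norm (powR_ge0 _ _)).
have dkle (x : R) : 0 < x -> `|kap * x `^ (b - 1)| <= `|kap| * x `^ (b - 1).
  by move=> x0; rewrite normrM (ger0_norm (powR_ge0 _ _)).
pose D (A : R) (a : R) := A / eta * (M + 1) `^ (a - eta + gam).
have D0 A a : 0 <= A -> 0 <= D A a.
  by move=> A0; rewrite !mulr_ge0 ?powR_ge0// invr_ge0 ltW.
pose C1 := D `|kap| (b + 0).
pose C2 := `|kap| * (4 * D `|b - 1| (b - 1 + 3 / 4)).
pose C3 := `|kap| * (`|b - 1| * (16 * D `|b - 2| (b - 2 + 3 / 2)) +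
   (16 + 8 * k%:R) * D `|b - 1| (b - 1 + 2^-1)).
have C10 : 0 <= C1 by exact: D0.
have C20 : 0 <= C2 by rewrite mulr_ge0// mulr_ge0// D0.
have C30 : 0 <= C3.
  rewrite mulr_ge0// addr_ge0//; first by rewrite mulr_ge0// mulr_ge0// D0.
  by rewrite mulr_ge0 ?D0// addr_ge0// mulr_ge0.
exists (C1 + C2 + C3); first by rewrite !addr_ge0.
move=> h hB W0 e e' e'0 e'e e1.
have WM : W h <= M by exact: W_le.
pose X := W h `^ (- gam) * e `^ eta.
have X0 : 0 <= X by rewrite mulr_ge0 ?powR_ge0.
have tot Ci : Ci <= C1 + C2 + C3 -> Ci * X <= (C1 + C2 + C3) * X.
  by move=> ?; rewrite ler_wpM2r.
split.
- apply: le_trans (tot C1 _); last by rewrite -addrA lerDl addr_ge0.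
  have s0 : 0 <= b + 0 - eta + gam by lra.
  have := @rate_le _ psi _ _ b 0 gam eta M psiE dkle (normr_ge0 _) (lexx _) gam0
    eta0 eta1 s0 _ e e' W0 WM e'0 e'e e1.
  by rewrite powRr0 mul1r.
- move=> i; apply: le_trans (tot C2 _); last by rewrite addrAC lerDr addr_ge0.
  have s0 : 0 <= b - 1 + 3 / 4 - eta + gam by lra.
  have q0 : (0 : R) <= 3 / 4 by lra.
  have := @rate_le _ _ _ _ (b - 1) (3 / 4) gam eta M (dpow _) (dple _) (normr_ge0 _) q0 gam0
    eta0 eta1 s0 _ e e' W0 WM e'0 e'e e1.
  move=> H; rewrite -/X -/(D _ _) in H.
  rewrite /XK -mulrBr -mulrBl normrM /C2 -mulrA ler_wpM2l// normrM.
  rewrite -mulrA; apply: le_trans (ler_wpM2l _ H) => //.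
  by rewrite mulrC mulrA ler_wpM2r// XW_le.
- move=> i j; apply: le_trans (tot C3 _); last by rewrite lerDr addr_ge0.
  have s2 : 0 <= b - 2 + 3 / 2 - eta + gam by lra.
  have s1 : 0 <= b - 1 + 2^-1 - eta + gam by lra.
  have q2 : (0 : R) <= 3 / 2 by lra.
  have q1 : (0 : R) <= 2^-1 by lra.
  have H2 := @rate_le _ _ _ _ (b - 2) (3 / 2) gam eta M (dpow _) (dple _) (normr_ge0 _) q2
    gam0 eta0 eta1 s2 _ e e' W0 WM e'0 e'e e1.
  have H1 := @rate_le _ _ _ _ (b - 1) 2^-1 gam eta M (dpow _) (dple _) (normr_ge0 _) q1
    gam0 eta0 eta1 s1 _ e e' W0 WM e'0 e'e e1.
  rewrite -/X -/(D _ _) in H1; rewrite -/X -/(D _ _) in H2.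
  rewrite /XXK -mulrBr normrM /C3 -[leRHS]mulrA ler_wpM2l//.
  rewrite [X in `|X| <= _](_ : _ =
    (b - 1) * ((W h + e) `^ (b - 2) - (W h + e') `^ (b - 2)) * (XW c i h * XW c j h) +
    ((W h + e) `^ (b - 1) - (W h + e') `^ (b - 1)) * XXW c i j h); last by ring.
  apply: le_trans (ler_normD _ _) _; rewrite [leRHS]mulrDl; apply: lerD.
    rewrite !normrM -[leLHS]mulrA -[leRHS]mulrA ler_wpM2l// -[leRHS]mulrA.
    apply: le_trans (ler_wpM2l (_ : 0 <= 16) H2) => //.
    rewrite mulrC mulrA ler_wpM2r//.
    have -> : 16 * W h `^ (3 / 2) = (4 * W h `^ (3 / 4)) * (4 * W h `^ (3 / 4)).
      by rewrite (_ : 3 / 2 = 3 / 4 + 3 / 4) ?powRDp//; [ring|lra].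
    by rewrite ler_pM// XW_le.
  rewrite normrM -[leRHS]mulrA; apply: le_trans (ler_wpM2l _ H1).
    by rewrite mulrC mulrA ler_wpM2r// XXW_le.
  by rewrite addr_ge0// mulr_ge0.
Qed.

End kernels.

(** * Potentials *)

Section density.
Context {R : realType} {m k : nat}.
Notation G := (G R m k).
Notation P := (@of_coords R m k).

Lemma of_coords_cvg (w : nat -> nat -> R) v : (forall i, (w ^~ i) @ \oo --> v i) ->
  (fun j => P (w j)) @ \oo --> P v.
Proof.
move=> wv.
have H n (f : nat -> 'rV[R]_n) (u : 'rV[R]_n) :
    (forall i, (fun j => f j 0 i) @ \oo --> u 0 i) -> f @ \oo --> u.
  move=> fu; apply/cvg_ballP => e e0.
  have : \forall j \near \oo, forall i, ball (u 0 i) e (f j 0 i).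
    by apply: filter_forall => i; have /cvg_ballP := fu i; apply.
  by apply: filterS => j hj; split => // i i'; rewrite ord1; exact: hj.
apply: (cvg_pair (H _ (fun j => (P (w j)).1) (P v).1 _) (H _ (fun j => (P (w j)).2) (P v).2 _)) => i.
  by under eq_fun do rewrite mxE; rewrite mxE; exact: wv.
by under eq_fun do rewrite mxE; rewrite mxE; exact: wv.
Qed.

Lemma gauge_coord (g : G) (r : R) : gauge g <= r ->
  (forall i, `|g.1 0 i| <= `|r|) /\ (forall s, `|g.2 0 s| <= r ^+ 2).
Proof.
rewrite /gauge -/(W g) => gr.
have r0 : 0 <= r by apply: le_trans gr; exact: sqrtr_ge0.
have yr : Num.sqrt (W g) <= r ^+ 2.
  rewrite -[leLHS]sqr_sqrtr ?sqrtr_ge0//.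
  by apply: lerXn2r => //; rewrite nnegrE// sqrtr_ge0.
have S x : 0 <= x -> x ^+ 2 <= W g -> x <= r ^+ 2.
  move=> x0 xW; apply: le_trans yr; rewrite -(ler_sqr _ _) ?nnegrE ?sqrtr_ge0//.
  by rewrite sqr_sqrtr// W_ge0.
split=> [i|s].
  rewrite -(ler_sqr _ _) ?nnegrE// !real_normK ?num_real//; apply: S; first exact: sqr_ge0.
  apply: le_trans (_ : sqn R g.1 ^+ 2 <= _); last by rewrite lerDl mulr_ge0// sqn_ge0.
  by rewrite lerXn2r ?nnegrE ?sqr_ge0 ?sqn_ge0// sqr_le_sqn.
apply: S => //; rewrite real_normK ?num_real//.
apply: le_trans (sqr_le_sqn g.2 s) _; rewrite /W.
have := sqr_ge0 (sqn R g.1); have := sqn_ge0 g.2; lra.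
Qed.

Lemma density_bounded (rho : G -> R) : continuous rho ->
  (exists r : R, forall g, r < gauge g -> rho g = 0) ->
  exists C L : R, [/\ 0 <= C, 0 <= L, forall g, `|rho g| <= C &
    forall v i, (i < m + k)%N -> L < `|v i| -> rho (P v) = 0].
Proof.
move=> rc [r hr]; pose L := `|r| + r ^+ 2.
have L0 : 0 <= L by rewrite addr_ge0// sqr_ge0.
have rL : `|r| <= L by rewrite lerDl sqr_ge0.
have r2L : r ^+ 2 <= L by rewrite lerDr.
have supp g : ~ inbox L g -> rho g = 0.
  move=> hg; apply: hr; rewrite ltNge; apply/negP => /gauge_coord[h1 h2]; apply: hg.
  by split=> i; [exact: le_trans (h1 i) _|exact: le_trans (h2 i) _].
have cK : compact ([set z : 'rV[R]_m | forall i, `[- L, L]%classic (z ord0 i)] `*`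
                   [set t : 'rV[R]_k | forall i, `[- L, L]%classic (t ord0 i)]).
  by apply: compact_setX; apply: (@rV_compact _ _ (fun=> `[- L, L]%classic)) => i; exact: segment_compact.
have cR := continuous_compact (continuous_subspaceT rc) cK.
have [C [Cr hC]] := compact_bounded cR.
have C1 : C < `|C| + 1 by rewrite (le_lt_trans (ler_norm C))// ltrDl.
exists (`|C| + 1), L; split => //.
  move=> g; have [[h1 h2]|ng] := pselect (inbox L g); last by rewrite supp// normr0.
  apply: (hC _ C1); exists g => //; split => /= i; rewrite in_itv/= -ler_norml.
    exact: h1.
  exact: h2.
move=> v i imk Lv; apply: supp => -[h1 h2].
have [im|mi] := ltnP i m.
  by have := h1 (Ordinal im); rewrite mxE /= leNgt Lv.
have ik : (i - m < k)%N by rewrite ltn_subLR.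
by have := h2 (Ordinal ik); rewrite mxE /= subnKC// leNgt Lv.
Qed.

End density.

Section potential.
Context {R : realType} {m k : nat} (c : 'I_k -> 'M[R]_m).
Hypothesis csk : bracket_skew c.
Notation G := (G R m k).
Notation P := (@of_coords R m k).
Implicit Types (g h : G) (u : G -> R).
Variables (rho : G -> R) (Cr L : R).
Hypothesis rho_cont : continuous rho.
Hypothesis Cr0 : 0 <= Cr.
Hypothesis L0 : 0 <= L.
Hypothesis rho_le : forall g, `|rho g| <= Cr.
Hypothesis rho_supp : forall v i, (i < m + k)%N -> L < `|v i| -> rho (P v) = 0.

Definition cnorm : R := \sum_r \sum_l \sum_i `|c r l i|.

Lemma cnorm_ge0 : 0 <= cnorm.
Proof. by do 3 (apply: sumr_ge0 => ? _). Qed.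

Lemma bracket_le (A B : R) (y z : 'rV[R]_m) r : (forall i, `|y 0 i| <= A) ->
  (forall i, `|z 0 i| <= B) -> `|bracket c y z 0 r| <= cnorm * (A * B).
Proof.
move=> yA zB; rewrite bracketE.
(* When [m = 0] the signs of [A] and [B] are unknown, but both sides vanish. *)
have [i0|n0] := pickP 'I_m; last first.
  have E (F : 'I_m -> R) : \sum_i F i = 0 by apply: big1 => i _; have := n0 i.
  by rewrite E normr0 /cnorm big1 ?mul0r// => s _; exact: E.
move=> _; have A0 : 0 <= A := le_trans (normr_ge0 _) (yA i0).
have B0 : 0 <= B := le_trans (normr_ge0 _) (zB i0).
have cr : \sum_l \sum_i `|c r l i| <= cnorm.
  rewrite /cnorm (bigD1 r)//= lerDl; apply: sumr_ge0 => ? _.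
  by do 2 (apply: sumr_ge0 => ? _).
apply: le_trans (ler_wpM2r (mulr_ge0 A0 B0) cr).
rewrite exchange_big /= mulr_suml; apply: le_trans (ler_norm_sum _ _ _) _.
apply: ler_sum => i _; rewrite normrM mulr_suml.
have : `|cz c r y i| <= \sum_l `|c r l i| * A.
  apply: le_trans (ler_norm_sum _ _ _) _; apply: ler_sum => l _.
  by rewrite normrM mulrC ler_wpM2l.
move=> H; apply: le_trans (ler_pM _ _ H (zB i)) _ => //.
by rewrite mulr_suml; apply: ler_sum => l _; rewrite mulrA.
Qed.

(** Half-width of a box containing [v^-1 g] for [v] in the box of the density and [g] in the box of
    half-width [B]. *)
Definition shift_box (B : R) : R := L + B + cnorm * (L * B).

Definition integrand u g (v : nat -> R) : R := rho (P v) * u (gmul c (ginv (P v)) g).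

(** With [g] as the right factor, left-invariant fields act on the kernel alone. The theorem
    integrates over [g^-1 g'] instead; symmetry of the gauge under inversion reconciles the two. *)
Definition pot u g : R := haar_int (fun g' => rho g' * u (gmul c (ginv g') g)).

Lemma potE u g : pot u g = iint R (m + k) (integrand u g).
Proof. by []. Qed.

Lemma diff_z v g i : (gmul c (ginv (P v)) g).1 0 i = g.1 0 i - v i.
Proof. by rewrite /= rowDE rowNE mxE addrC. Qed.

Lemma diff_t v g r : (gmul c (ginv (P v)) g).2 0 r =
  g.2 0 r - v (m + r)%N - 2^-1 * bracket c (P v).1 g.1 0 r.
Proof.
rewrite /= !rowDE rowZE rowNE mxE -[- (\row_(i < m) v i)]scaleN1r.
have -> : bracket c (-1 *: \row_(i < m) v i) g.1 0 r = - bracket c (\row_(i < m) v i) g.1 0 r.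
  rewrite !bracketE -sumrN; apply: eq_bigr => i _.
  by rewrite czZ mulN1r mulNr.
by ring.
Qed.

Lemma inbox_diff B v g : (forall i, (i < m + k)%N -> `|v i| <= L) -> inbox B g ->
  inbox (shift_box B) (gmul c (ginv (P v)) g).
Proof.
move=> vL [g1 g2].
have vz (i : 'I_m) : `|v i| <= L by apply: vL; rewrite ltn_addr.
have [e|B0] := ltP B 0.
  have nm : 'I_m -> False.
    by move=> i; have := le_trans (normr_ge0 _) (g1 i); rewrite leNgt e.
  have nk : 'I_k -> False.
    by move=> i; have := le_trans (normr_ge0 _) (g2 i); rewrite leNgt e.
  by split=> i; [case: (nm i)|case: (nk i)].
have cLB : 0 <= cnorm * (L * B) by rewrite mulr_ge0 ?cnorm_ge0// mulr_ge0.
split=> i.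
  rewrite diff_z /shift_box; have := ler_normB (g.1 0 i) (v i).
  have := g1 i; have := vz i; lra.
rewrite diff_t /shift_box.
have h1 := ler_normB (g.2 0 i - v (m + i)%N) (2^-1 * bracket c (P v).1 g.1 0 i).
have h2 := ler_normB (g.2 0 i) (v (m + i)%N).
have h3 := g2 i.
have h4 : `|v (m + i)%N| <= L by apply: vL; rewrite ltn_add2l.
have h5 : `|bracket c (P v).1 g.1 0 i| <= cnorm * (L * B).
  by apply: bracket_le => // j; rewrite mxE.
have h6 : `|2^-1 * bracket c (P v).1 g.1 0 i| <= 2^-1 * (cnorm * (L * B)).
  by rewrite normrM ger0_norm// ler_pM2l.
lra.
Qed.

Lemma integrand_out u g v i : (i < m + k)%N -> L < `|v i| -> integrand u g v = 0.
Proof. by move=> im Lv; rewrite /integrand (rho_supp im Lv) mul0r. Qed.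

Lemma integrand_le u g B C v : 0 <= C -> inbox B g ->
  (forall h, inbox (shift_box B) h -> `|u h| <= C) -> `|integrand u g v| <= Cr * C.
Proof.
move=> C0 gB uC.
have [vL|] := pselect (forall i, (i < m + k)%N -> `|v i| <= L).
  by rewrite normrM ler_pM//; apply/uC/inbox_diff.
move=> /existsNP[i] /not_implyP[im /negP]; rewrite -ltNge => Lv.
by rewrite (integrand_out _ _ im Lv) normr0 mulr_ge0.
Qed.

Lemma diff_cvg (w : nat -> nat -> R) v g : (forall i, (w ^~ i) @ \oo --> v i) ->
  (forall i, (fun j => (gmul c (ginv (P (w j))) g).1 0 i) @ \oo -->
             (gmul c (ginv (P v)) g).1 0 i) /\
  (forall r, (fun j => (gmul c (ginv (P (w j))) g).2 0 r) @ \oo -->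
             (gmul c (ginv (P v)) g).2 0 r).
Proof.
move=> wv; split=> i.
  under eq_fun do rewrite diff_z; rewrite diff_z.
  by apply: cvgB; [exact: cvg_cst|exact: wv].
under eq_fun do rewrite diff_t; rewrite diff_t.
apply: cvgB; first by apply: cvgB; [exact: cvg_cst|exact: wv].
apply: cvgMr; under eq_fun do rewrite bracketE; rewrite bracketE.
apply: cvg_big => [|j _]; first exact: add_continuous.
apply: cvgMl; rewrite /cz; apply: cvg_big => [|l _]; first exact: add_continuous.
by apply: cvgMl; under eq_fun do rewrite mxE; rewrite mxE; exact: wv.
Qed.

Definition test_integrand C u g := test_fun (m + k) C L (integrand u g).

Lemma smooth_test_integrand e u B : 0 < e -> smooth e u -> exists2 C, 0 <= C &
  forall g, inbox B g -> test_integrand C u g.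
Proof.
move=> e0 su; have [C C0 uC] := smooth_bounded e0 su (shift_box B).
exists (Cr * C); first exact: mulr_ge0.
move=> g gB; split.
- by move=> v; exact: integrand_le gB uC.
- by move=> v i; exact: integrand_out.
- move=> w v wv; apply: cvgM.
    by apply: (cvg_comp _ _ (of_coords_cvg wv)); exact: rho_cont.
  have [h1 h2] := diff_cvg g wv.
  exact: (smooth_cvg e0 su h1 h2).
Qed.

Definition gbox g : R := \sum_i `|g.1 0 i| + \sum_r `|g.2 0 r|.

Lemma gboxP g : inbox (gbox g) g.
Proof.
split=> i; rewrite /gbox (bigD1 i)//=.
  by rewrite -addrA lerDl addr_ge0//; apply: sumr_ge0.
by rewrite addrCA lerDl addr_ge0//; apply: sumr_ge0.
Qed.

Lemma inbox_curve B g i s : 0 <= B -> inbox B g -> `|s| <= 1 ->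
  inbox (B + 1 + cnorm * B) (gmul c g (Defs.expe i s)).
Proof.
move=> B0 [g1 g2] s1; have cB : 0 <= cnorm * B by rewrite mulr_ge0 ?cnorm_ge0.
split=> j.
  rewrite curve_z; have := ler_normD (g.1 0 j) (s * (j == i)%:R).
  have : `|s * (j == i)%:R| <= 1.
    by rewrite normrM; case: (j == i); rewrite ?normr1 ?mulr1// normr0 mulr0.
  have := g1 j; lra.
rewrite curve_t; have := ler_normD (g.2 0 j) (s * (2^-1 * cz c j g.1 i)).
have : `|cz c j g.1 i| <= cnorm * B.
  have := @bracket_le B 1 g.1 (delta_mx 0 i) j g1 _.
  rewrite -[delta_mx 0 i]scale1r bracket_delta mul1r mulr1; apply => l.
  by rewrite rowZE mul1r mxE eqxx; case: (l == i); rewrite ?normr1 ?normr0.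
have : `|s * (2^-1 * cz c j g.1 i)| <= 2^-1 * `|cz c j g.1 i|.
  rewrite !normrM (ger0_norm (_ : 0 <= 2^-1))// -[leRHS]mul1r ler_wpM2r//.
have := g2 j; lra.
Qed.

(** Differentiation under the iterated integral by a uniform Taylor remainder: the bound [C s^2] on
    the integrand is integrated through linearity and [iint_cvg]. It uses that [X_i u'] is bounded
    on boxes. *)
Lemma pot_dX e u u' i : 0 < e -> smooth e u -> smooth e u' -> dX c i u u' ->
  dX c i (pot u) (pot u').
Proof.
move=> e0 su su' du g.
have [u'' su'' du'] := smooth_dX c e0 i su'.
set B0 := gbox g; have gB0 : inbox B0 g := gboxP g.
have B00 : 0 <= B0 by rewrite addr_ge0//; apply: sumr_ge0.
set B := B0 + 1 + cnorm * B0.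
have B0B : B0 <= B by rewrite /B -addrA lerDl addr_ge0// mulr_ge0// cnorm_ge0.
have [C C0 uC] := smooth_bounded e0 su'' (shift_box B).
have gB s : `|s| <= 1 -> inbox B (gmul c g (Defs.expe i s)).
  by move=> s1; exact: inbox_curve.
have [C1 C10 G1] := smooth_test_integrand B e0 su.
have [C2 C20 G2] := smooth_test_integrand B e0 su'.
apply: (@is_derive_quad _ _ _ (Cr * C * (2 * L) ^+ (m + k))) => s s1.
have gg : inbox B g by rewrite -(expe0 c g i); apply: gB; rewrite normr0.
rewrite expe0 !potE.
have f1 := G1 _ (gB _ s1).
have f2 := test_funZ (-1) (G1 _ gg).
have f3 := test_funZ (- s) (G2 _ gg).
have f12 := test_funD f1 f2.
have f123 := test_funD f12 f3.
have p2 : 0 <= `|-1| * C1 by rewrite mulr_ge0.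
have p3 : 0 <= `|- s| * C2 by rewrite mulr_ge0.
rewrite -mulN1r -mulNr -(iintZ _ C10 L0 (G1 _ gg)) -(iintZ _ C20 L0 (G2 _ gg)).
rewrite -(iintD C10 p2 L0 f1 f2) -(iintD (addr_ge0 C10 p2) p3 L0 f12 f3).
rewrite mulrAC; apply: (iint_cvg (m + k) _ L0).1.
  by rewrite mulr_ge0 ?sqr_ge0// mulr_ge0.
have [_ f123L f123c] := f123; split => // v.
rewrite /integrand -gmulA.
have [vL|] := pselect (forall i, (i < m + k)%N -> `|v i| <= L); last first.
  move=> /existsNP[j] /not_implyP[jm /negP]; rewrite -ltNge => Lv.
  by rewrite (rho_supp jm Lv) !mul0r !mulr0 !addr0 normr0 mulr_ge0 ?sqr_ge0// mulr_ge0.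
set h := gmul c (ginv (P v)) g.
rewrite [X in `|X| <= _](_ : _ = rho (P v) *
   (u (gmul c h (Defs.expe i s)) - u h - s * u' h)); last by ring.
rewrite normrM -mulrA ler_pM//.
have := @taylor2 _ (fun s => u (gmul c h (Defs.expe i s)))
  (fun s => u' (gmul c h (Defs.expe i s))) (fun s => u'' (gmul c h (Defs.expe i s))) C.
rewrite !expe0; apply => // x.
- exact: dX_at.
- exact: dX_at.
- by move=> x1; apply: uC; rewrite gmulA; apply: inbox_diff => //; exact: gB.
Qed.

End potential.

(** * Domination of negative powers of the gauge by powers of the coordinates *)

Section gauge_bound.
Context {R : realType} {m k : nat}.
Notation G := (G R m k).
Implicit Types h : G.

Lemma coord1_leW h i : `|h.1 0 i| <= W h `^ (1 / 4).
Proof.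
rewrite -(ler_sqr _ _) ?nnegrE ?powR_ge0// real_normK ?num_real//.
apply: le_trans (sqr_le_sqn _ _) _; apply: le_trans (sqn1_leW _) _.
rewrite -powR_mulrn ?powR_ge0// -powRrM (_ : 1 / 4 * 2%:R = 2^-1)//; lra.
Qed.

Lemma coord2_leW h r : `|h.2 0 r| <= W h `^ 2^-1.
Proof.
apply: le_sqrtW => //; rewrite real_normK ?num_real// /W.
have := sqr_le_sqn h.2 r; have := sqr_ge0 (sqn R h.1); have := sqn_ge0 h.2; lra.
Qed.

Lemma W_le_prod (d : R) h : 0 < d -> 0 < W h ->
  (forall i, h.1 0 i != 0) -> (forall r, h.2 0 r != 0) ->
  W h `^ (- (d * (m + 2 * k)%:R / 4)) <=
  \prod_i `|h.1 0 i| `^ (- d) * \prod_r `|h.2 0 r| `^ (- d).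
Proof.
move=> d0 W0 h1 h2; have Wp x : 0 <= W h `^ x by exact: powR_ge0.
have -> : W h `^ (- (d * (m + 2 * k)%:R / 4)) =
    \prod_(i < m) W h `^ (1 / 4 * - d) * \prod_(r < k) W h `^ (2^-1 * - d).
  rewrite !prodr_const !card_ord -!powR_mulrn// -!powRrM -powRDp//.
  by congr (_ `^ _); rewrite natrD natrM; field.
have nd : - d <= 0 by rewrite oppr_le0 ltW.
apply: ler_pM; try by apply: prodr_ge0.
  apply: ler_prod => i _; rewrite Wp/= powRrM powR_gex ?normr_gt0//.
  exact: coord1_leW.
apply: ler_prod => i _; rewrite Wp/= powRrM powR_gex ?normr_gt0//.
exact: coord2_leW.
Qed.

Lemma W_gt0 h r : h.2 0 r != 0 -> 0 < W h.
Proof.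
move=> h2; have : 0 < h.2 0 r ^+ 2 by rewrite lt_neqAle eq_sym sqrf_eq0 h2 sqr_ge0.
have := sqr_le_sqn h.2 r; have := sqr_ge0 (sqn R h.1); rewrite /W; lra.
Qed.

Lemma phiN (d L x : R) : phi d L (- x) = phi d L x.
Proof. by rewrite /phi !boxE normrN. Qed.

End gauge_bound.

Section singular.
Context {R : realType} {m k : nat} (c : 'I_k -> 'M[R]_m).
Hypothesis k0 : (0 < k)%N.
Notation G := (G R m k).
Notation P := (@of_coords R m k).
Implicit Types (g h : G) (u : G -> R).
Variables (rho : G -> R) (Cr L : R).
Hypothesis Cr0 : 0 <= Cr.
Hypothesis L0 : 0 <= L.
Hypothesis rho_le : forall g, `|rho g| <= Cr.
Hypothesis rho_supp : forall v i, (i < m + k)%N -> L < `|v i| -> rho (P v) = 0.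
Local Notation pot := (pot c rho).
Local Notation test_integrand := (test_integrand c rho L).
Local Notation shift_box := (shift_box c L).

Variables (d gam : R).
Hypothesis d0 : 0 < d.
Hypothesis d1 : d < 1.
Hypothesis gamE : gam = d * (m + 2 * k)%:R / 4.

(* For fixed [g] the coordinates of [v^-1 g] vanish on the graphs [v i = acoord g i v], and
   [acoord g i v] only depends on the first [i] coordinates of [v]. *)
Let apos g (v : nat -> R) : 'rV[R]_(m + k) :=
  row_mx g.1 (\row_r (g.2 0 r - 2^-1 * bracket c (P v).1 g.1 0 r)).

Let acoord g (i : nat) (v : nat -> R) : R :=
  oapp (fun j => apos g v 0 j) 0 (insub i : option 'I_(m + k)).

Lemma acoordE g v (i : 'I_(m + k)) : acoord g i v = apos g v 0 i.
Proof. by rewrite /acoord valK. Qed.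

Lemma acoord_l g (v : nat -> R) (i : 'I_m) :
  v (lshift k i) - acoord g (lshift k i) v = - (gmul c (ginv (P v)) g).1 0 i.
Proof. by rewrite acoordE /apos row_mxEl diff_z opprB. Qed.

Lemma acoord_r g (v : nat -> R) (r : 'I_k) :
  v (rshift m r) - acoord g (rshift m r) v = - (gmul c (ginv (P v)) g).2 0 r.
Proof. by rewrite acoordE /apos row_mxEr diff_t [in LHS]mxE /=; ring. Qed.

Lemma acoord_dep g i v v' : (forall j, (j < i)%N -> v j = v' j) ->
  acoord g i v = acoord g i v'.
Proof.
rewrite /acoord; case: insubP => [j _ <-|//] vv /=.
case: (split_ordP j) vv => l -> vv; first by rewrite /apos !row_mxEl.
rewrite /apos !row_mxEr !mxE; congr (_ - _ * _).
suff -> : (P v).1 = (P v').1 by [].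
by apply/rowP => x; rewrite !mxE; apply: vv; rewrite /= ltn_addr.
Qed.

Definition admissible u g := exists2 C, 0 <= C & test_integrand C u g.

(** [D] depends neither on [g] in the box nor on the sup bounds of the approximants [u j], which may
    blow up as the regularisation is removed; only the weighted differences count. *)
Lemma pot_sing B : 0 <= B -> exists2 D, 0 <= D &
  forall g, inbox B g -> forall (U : G -> R) (u : nat -> G -> R) (w : nat -> R),
    (forall j, admissible (u j) g) ->
    (forall j, 0 <= w j) -> w @ \oo --> 0 ->
    (forall j h, inbox (shift_box B) h -> 0 < W h ->
       `|U h - u j h| <= w j * W h `^ (- gam)) ->
    forall j, `|pot U g - pot (u j) g| <= w j * D.
Proof.
move=> B0; have S0 : 0 < shift_box B + 1.
  by rewrite ltr_wpDl// !addr_ge0// mulr_ge0 ?cnorm_ge0// mulr_ge0.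
have [cc cc0 hcc] := phi_int d0 d1 S0.
exists (Cr * cc ^+ (m + k)); first by rewrite mulr_ge0 ?exprn_ge0.
move=> g gB U u w adm w0 wc Uu j.
have /choice[C] : forall j, exists C, 0 <= C /\ test_integrand C (u j) g.
  by move=> i; have [C] := adm i; exists C.
move=> /all_and2[C0 ug].
rewrite !potE mulrA [w j * _]mulrC.
apply: (iint_sing cc0 hcc L0 C0 (h := fun j => integrand c rho (u j) g)
   (w := fun j => Cr * w j) (a := acoord g)) => //.
- by move=> i v v'; exact: acoord_dep.
- by move=> i; rewrite mulr_ge0.
- by rewrite -[X in _ --> X](mulr0 Cr); apply: cvgMr.
move=> i v vi.
have prod0 : 0 <= \prod_(l < m + k) phi d (shift_box B + 1) (v l - acoord g l v).
  by apply: prodr_ge0 => l _; exact: phi_ge0.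
have [vL|] := pselect (forall l, (l < m + k)%N -> `|v l| <= L); last first.
  move=> /existsNP[l] /not_implyP[lm /negP]; rewrite -ltNge => Lv.
  rewrite !(integrand_out c rho_supp _ _ lm Lv) subrr normr0.
  by rewrite mulr_ge0// mulr_ge0.
rewrite /integrand -mulrBr normrM -mulrA; apply: ler_pM => //.
set h := gmul c (ginv (P v)) g.
have hB : inbox (shift_box B) h by exact: inbox_diff.
have h1 l : h.1 0 l != 0.
  rewrite -oppr_eq0 -acoord_l subr_eq0; apply: vi; exact: ltn_ord.
have h2 l : h.2 0 l != 0.
  rewrite -oppr_eq0 -acoord_r subr_eq0; apply: vi; exact: ltn_ord.
(* Off the graphs no coordinate of [h] vanishes, and [k > 0] supplies one that keeps [h] away from
   the pole. *)
have W0 : 0 < W h := W_gt0 (h2 (Ordinal k0)).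
apply: le_trans (Uu i h hB W0) _; apply: ler_wpM2l => //.
rewrite gamE; apply: le_trans (W_le_prod d0 W0 h1 h2) _.
rewrite big_split_ord /= le_eqVlt; apply/orP; left; apply/eqP; congr (_ * _);
  apply: eq_bigr => l _.
  rewrite acoord_l phiN /phi boxE; have [hl _] := hB.
  by rewrite (le_trans (hl l)) ?mulr1// lerDl.
rewrite acoord_r phiN /phi boxE; have [_ hl] := hB.
by rewrite (le_trans (hl l)) ?mulr1// lerDl.
Qed.

Lemma pot_lin I (s : seq I) (a : I -> R) (u : I -> G -> R) g :
  (forall i, admissible (u i) g) ->
  admissible (fun h => \sum_(i <- s) a i * u i h) g /\
  pot (fun h => \sum_(i <- s) a i * u i h) g = \sum_(i <- s) a i * pot (u i) g.
Proof.
move=> ug; elim: s => [|i s [[C' C'0 IHg] IH]].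
  under eq_fun do rewrite big_nil; rewrite big_nil.
  have E : integrand c rho (fun=> 0) g = cst 0 by apply/funext => v; rewrite /integrand mulr0.
  split; last by rewrite potE E iint0.
  by exists 0 => //; rewrite /test_integrand E; exact: test_fun0.
have [C C0 gi0] := ug i; have gi := test_funZ (a i) gi0.
have E : integrand c rho (fun h => \sum_(j <- i :: s) a j * u j h) g =
    (fun v => a i * integrand c rho (u i) g v +
              integrand c rho (fun h => \sum_(i <- s) a i * u i h) g v).
  by apply/funext => v; rewrite /integrand big_cons; ring.
have aC : 0 <= `|a i| * C by rewrite mulr_ge0.
split.
  exists (`|a i| * C + C'); first by rewrite addr_ge0.
  by rewrite /test_integrand E; exact: test_funD.
by rewrite potE E big_cons -IH (iintD aC C'0 L0 gi IHg) (iintZ _ C0 L0 gi0).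
Qed.

Lemma pot_diff B : 0 <= B -> exists2 D, 0 <= D &
  forall g, inbox B g -> forall (u u' : G -> R) w,
    admissible u g -> admissible u' g -> 0 <= w ->
    (forall h, inbox (shift_box B) h -> 0 < W h -> `|u h - u' h| <= w * W h `^ (- gam)) ->
    `|pot u g - pot u' g| <= w * D.
Proof.
move=> B0; have [D D0 H] := pot_sing B0; exists D => // g gB u u' w gu gu' w0 uu'.
(* [pot_sing] wants a sequence with rates tending to [0]; it is applied to the limit [0] and the
   approximants [(u - u') / (j + 1)], and the index [j = 0] is the claim. *)
pose a j (i : bool) : R := if i then harmonic j else - harmonic j.
pose v (i : bool) := if i then u else u'.
have adm i : admissible (v i) g by case: i.
have sE (F : bool -> R) : \sum_(i <- [:: true; false]) F i = F true + F false.
  by rewrite !big_cons big_nil addr0.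
have h0 j : 0 <= harmonic j :> R by rewrite invr_ge0.
have := H g gB (fun=> 0) (fun j h => \sum_(i <- [:: true; false]) a j i * v i h)
  (fun j => w * harmonic j) _ _ _ _ 0.
have [_ p0] := @pot_lin _ [::] (a 0) v g adm.
rewrite big_nil in p0.
have -> : pot (fun=> 0) g = 0.
  by rewrite -[RHS]p0; congr pot; apply/funext => h; rewrite big_nil.
rewrite (pot_lin _ _ adm).2 sE /a/= /harmonic invr1 mulN1r mul1r sub0r normrN mulr1.
apply.
- by move=> j; exact: (pot_lin _ _ adm).1.
- by move=> j; rewrite mulr_ge0 ?invr_ge0.
- rewrite -[X in _ --> X](mulr0 w); apply: cvgMr; exact: cvg_harmonic.
- move=> j h hB W0; rewrite sE sub0r normrN mulNr -mulrBr normrM mulrC mulrAC.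
  rewrite (ger0_norm (_ : 0 <= j.+1%:R^-1)) ?invr_ge0// ler_wpM2r ?invr_ge0//.
  exact: uu'.
Qed.

End singular.

(** * Removal of the regularisation *)

Section limit.
Context {R : realType} {m k : nat} (c : 'I_k -> 'M[R]_m).
Hypothesis csk : bracket_skew c.
Hypothesis cH : Htype c.
Hypothesis k0 : (0 < k)%N.
Notation G := (G R m k).
Notation P := (@of_coords R m k).
Implicit Types (g h : G) (u : G -> R).
Variables (rho : G -> R) (Cr L : R).
Hypothesis rho_cont : continuous rho.
Hypothesis rho_ge0 : forall g, 0 <= rho g.
Hypothesis Cr0 : 0 <= Cr.
Hypothesis L0 : 0 <= L.
Hypothesis rho_le : forall g, `|rho g| <= Cr.
Hypothesis rho_supp : forall v i, (i < m + k)%N -> L < `|v i| -> rho (P v) = 0.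
Local Notation pot := (pot c rho).
Local Notation admissible := (admissible c rho L).

Variables (d gam eta : R).
Hypothesis d0 : 0 < d.
Hypothesis d1 : d < 1.
Hypothesis gamE : gam = d * (m + 2 * k)%:R / 4.
Variables (psi : R -> R) (kap b : R).
Hypothesis psiE : forall x : R, 0 < x -> is_derive x 1 psi (kap * x `^ (b - 1)).
Hypothesis psi_smooth : forall e, @smooth R m k e (K psi e).
Hypothesis eta0 : 0 < eta.
Hypothesis eta1 : eta <= 1.
Hypothesis bge : 0 <= b - 2^-1 - eta + gam.

Let e_ (n : nat) : R := harmonic n.
Let K0 (h : G) := psi (W h).
Local Notation Kn n := (@K R m k psi (e_ n)).
Local Notation XKn n := (XK c kap b (e_ n)).
Local Notation XXKn n := (XXK c kap b (e_ n)).

Let e_gt0 n : 0 < e_ n. Proof. by rewrite invr_gt0. Qed.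
Let e_le1 n : e_ n <= 1. Proof. by rewrite invf_le1// ler1n. Qed.
Let e_le n n' : (n <= n')%N -> e_ n' <= e_ n.
Proof. by move=> nn; rewrite lef_pV2 ?posrE// ler_nat. Qed.

Let gam0 : 0 <= gam.
Proof. by rewrite gamE divr_ge0// mulr_ge0// ltW. Qed.

Lemma smooth_XXK n i j : smooth (e_ n) (XXKn n i j).
Proof.
have [u su /dX_Xd du] := smooth_dX c (e_gt0 n) i (smooth_XK c kap b (e_ n) j).
suff <- : u = XXKn n i j by [].
by rewrite -du; apply: dX_Xd; exact: dX_XK.
Qed.

Lemma smooth_adm n u g : smooth (e_ n) u -> admissible u g.
Proof.
move=> su; have [C C0 H] := smooth_test_integrand c rho_cont Cr0 L0 rho_le rho_supp (gbox g) (e_gt0 n) su.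
by exists C => //; apply: H; exact: gboxP.
Qed.

(** The potential itself is compared with its limit, but its derivatives only with one another:
    their limits are identified afterwards by [derive_limit]. *)
Lemma pot_rates B : 0 <= B -> exists2 w : nat -> R, w @ \oo --> 0 &
  forall g, inbox B g ->
  [/\ forall n, `|pot K0 g - pot (Kn n) g| <= w n,
     forall n n' i, (n <= n')%N -> `|pot (XKn n i) g - pot (XKn n' i) g| <= w n &
     forall n n' i j, (n <= n')%N ->
       `|pot (XXKn n i j) g - pot (XXKn n' i j) g| <= w n].
Proof.
move=> B0.
have [C C0 HC] := kernel_rates csk cH psiE gam0 eta0 eta1 bge (shift_box c L B).
have [D1 D10 H1] := pot_sing c k0 Cr0 L0 rho_le rho_supp d0 d1 gamE B0.
have [D2 D20 H2] := pot_diff c k0 Cr0 L0 rho_le rho_supp d0 d1 gamE B0.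
pose w n := C * e_ n `^ eta.
have w0 n : 0 <= w n by rewrite mulr_ge0 ?powR_ge0.
have ec : (fun n => e_ n `^ eta) @ \oo --> 0.
  apply/cvgrPdist_lt => e e0.
  have e1 : 0 < e `^ (eta^-1) by rewrite powR_gt0.
  have /cvgrPdist_lt/(_ _ e1) := @cvg_harmonic R; apply: filterS => n.
  rewrite !sub0r !normrN !ger0_norm ?powR_ge0 ?invr_ge0// => h.
  rewrite -[e]powRr1 ?ltW// -(mulVf (lt0r_neq0 eta0)) powRrM.
  by apply: gt0_ltr_powR => //; rewrite nnegrE ?powR_ge0// ltW.
have wc : w @ \oo --> 0 by rewrite -[X in _ --> X](mulr0 C); apply: cvgMr.
exists (fun n => w n * (D1 + D2)).
  by rewrite -[X in _ --> X](mul0r (D1 + D2)); apply: cvgMl.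
move=> g gB.
have wD1 n : w n * D1 <= w n * (D1 + D2) by rewrite ler_wpM2l// lerDl.
have wD2 n : w n * D2 <= w n * (D1 + D2) by rewrite ler_wpM2l// lerDr.
split.
- move=> n; apply: le_trans (wD1 n).
  apply: (H1 g gB K0 (fun j => Kn j) w) => //.
    by move=> j; apply: smooth_adm (psi_smooth _).
  move=> j h hB W0.
  have cl : `|Kn j h - Kn n' h| @[n' --> \oo] --> `|Kn j h - K0 h|.
    apply: cvg_norm; apply: cvgB; first exact: cvg_cst.
    have cW : (fun n' => W h + e_ n') @ \oo --> W h.
      rewrite -[X in _ --> X]addr0; apply: cvgD; first exact: cvg_cst.
      exact: cvg_harmonic.
    exact: (cvg_comp _ psi cW (is_derive_cvg_self (psiE W0))).
  rewrite distrC -(cvg_lim _ cl)//; apply: limr_le; first by apply/cvg_ex; eexists; exact: cl.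
  exists j => // n' /= jn.
  have [h1 _ _] := HC h hB W0 _ _ (e_gt0 n') (e_le jn) (e_le1 j).
  by rewrite /w -mulrA [_ `^ _ * _]mulrC.
- move=> n n' i nn; apply: le_trans (wD2 n).
  apply: (H2 g gB) => //.
  + exact: smooth_adm (smooth_XK c kap b (e_ n) i).
  + exact: smooth_adm (smooth_XK c kap b (e_ n') i).
  move=> h hB W0.
  have [_ h1 _] := HC h hB W0 _ _ (e_gt0 n') (e_le nn) (e_le1 n).
  by rewrite /w -mulrA [_ `^ _ * _]mulrC.
- move=> n n' i j nn; apply: le_trans (wD2 n).
  apply: (H2 g gB) => //.
  + exact: smooth_adm (smooth_XXK n i j).
  + exact: smooth_adm (smooth_XXK n' i j).
  move=> h hB W0.
  have [_ _ h1] := HC h hB W0 _ _ (e_gt0 n') (e_le nn) (e_le1 n).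
  by rewrite /w -mulrA [_ `^ _ * _]mulrC.
Qed.

(** A single box contains the curve through [g0] for [|s| <= 1], so the rates are uniform along
    it. *)
Lemma pot_limit g0 : exists2 w : nat -> R, w @ \oo --> 0 &
  forall i s, `|s| <= 1 -> let g := gmul c g0 (Defs.expe i s) in
  [/\ forall n, `|pot K0 g - pot (Kn n) g| <= w n,
     forall n n' j, (n <= n')%N -> `|pot (XKn n j) g - pot (XKn n' j) g| <= w n &
     forall n n' l j, (n <= n')%N ->
       `|pot (XXKn n l j) g - pot (XXKn n' l j) g| <= w n].
Proof.
have g00 : 0 <= gbox g0 by rewrite addr_ge0//; apply: sumr_ge0.
have B0 : 0 <= gbox g0 + 1 + cnorm c * gbox g0.
  by rewrite addr_ge0 ?mulr_ge0 ?cnorm_ge0// addr_ge0.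
have [w wc H] := pot_rates B0; exists w => // i s s1 /=.
by apply: H; apply: inbox_curve => //; exact: gboxP.
Qed.

Lemma dist_cvg (f : nat -> R) (l : R) (w : nat -> R) : w @ \oo --> 0 ->
  (forall n, `|l - f n| <= w n) -> f @ \oo --> l.
Proof.
move=> wc fl; apply/cvgrPdist_le => e e0.
move: wc => /cvgrPdist_le/(_ _ e0); apply: filterS => n; rewrite sub0r normrN.
by move=> wn; apply: le_trans (fl n) _; apply: le_trans wn; exact: ler_norm.
Qed.

Lemma pot_K0_cvg g : (fun n => pot (Kn n) g) @ \oo --> pot K0 g.
Proof.
have g0 : 0 <= gbox g by rewrite addr_ge0//; apply: sumr_ge0.
have [w wc H] := pot_rates g0.
by apply: dist_cvg wc _; have [] := H g (gboxP g).
Qed.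

Lemma pot_dXK n i : dX c i (pot (Kn n)) (pot (XKn n i)).
Proof.
by apply: (pot_dX csk rho_cont Cr0 L0 rho_le rho_supp (e_gt0 n)) => //;
  [exact: smooth_XK|exact: dX_K].
Qed.

Lemma pot_dXXK n i j : dX c i (pot (XKn n j)) (pot (XXKn n i j)).
Proof.
by apply: (pot_dX csk rho_cont Cr0 L0 rho_le rho_supp (e_gt0 n));
  [exact: smooth_XK|exact: smooth_XXK|exact: dX_XK].
Qed.

Lemma pot_first i : dX c i (pot K0) (Xd c (pot K0) i) /\
  forall g, (fun n => pot (XKn n i) g) @ \oo --> Xd c (pot K0) i g.
Proof.
suff H g : exists2 l, (fun n => pot (XKn n i) g) @ \oo --> l &
    is_derive (0 : R) 1 (fun s => pot K0 (gmul c g (Defs.expe i s))) l.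
  have E g l : is_derive (0 : R) 1 (fun s => pot K0 (gmul c g (Defs.expe i s))) l ->
      Xd c (pot K0) i g = l by rewrite /Xd derive1E => -[_ ->].
  by split=> g; have [l h1 h2] := H g; rewrite (E _ _ h2).
have [w wc Hw] := pot_limit g.
have := @derive_limit _ (fun n s => pot (Kn n) (gmul c g (Defs.expe i s)))
  (fun n s => pot (XKn n i) (gmul c g (Defs.expe i s)))
  (fun s => pot K0 (gmul c g (Defs.expe i s))) w _ _ wc _.
rewrite expe0; apply.
- by move=> n x; apply: (dX_at csk); exact: pot_dXK.
- by move=> x; exact: pot_K0_cvg.
- by move=> n n' x nn x1; have [_ h _] := Hw i x x1; exact: h.
Qed.

Lemma pot_second i j : dX c i (Xd c (pot K0) j) (Xd c (Xd c (pot K0) j) i) /\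
  forall g, (fun n => pot (XXKn n i j) g) @ \oo --> Xd c (Xd c (pot K0) j) i g.
Proof.
set u := Xd c (pot K0) j.
suff H g : exists2 l, (fun n => pot (XXKn n i j) g) @ \oo --> l &
    is_derive (0 : R) 1 (fun s => u (gmul c g (Defs.expe i s))) l.
  have E g l : is_derive (0 : R) 1 (fun s => u (gmul c g (Defs.expe i s))) l ->
      Xd c u i g = l by rewrite /Xd derive1E => -[_ ->].
  by split=> g; have [l h1 h2] := H g; rewrite (E _ _ h2).
have [w wc Hw] := pot_limit g.
have := @derive_limit _ (fun n s => pot (XKn n j) (gmul c g (Defs.expe i s)))
  (fun n s => pot (XXKn n i j) (gmul c g (Defs.expe i s)))
  (fun s => u (gmul c g (Defs.expe i s))) w _ _ wc _.
rewrite expe0; apply.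
- by move=> n x; apply: (dX_at csk); exact: pot_dXXK.
- by move=> x; exact: (pot_first j).2.
- by move=> n n' x nn x1; have [_ _ h] := Hw i x x1; exact: h.
Qed.

(** For constant coefficients the combination of second derivatives is the potential of the same
    combination of kernels; [rho >= 0] preserves its sign, and the limit in [n] does too. *)
Lemma pot_sign (sg : R) (a : 'I_m -> 'I_m -> R) g :
  (forall n h, 0 <= sg * \sum_i \sum_j a i j * XXKn n i j h) ->
  0 <= sg * \sum_i \sum_j a i j * Xd c (Xd c (pot K0) j) i g.
Proof.
move=> Hs.
have cl : (fun n => sg * \sum_i \sum_j a i j * pot (XXKn n i j) g) @ \oo -->
    sg * \sum_i \sum_j a i j * Xd c (Xd c (pot K0) j) i g.
  apply: cvgMr; apply: cvg_big => [|i _]; first exact: add_continuous.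
  apply: cvg_big => [|j _]; first exact: add_continuous.
  by apply: cvgMr; exact: (pot_second i j).2.
rewrite -(cvg_lim _ cl)//; apply: limr_ge; first by apply/cvg_ex; eexists; exact: cl.
apply: nearW => n.
have adm (p : 'I_m * 'I_m) : admissible (XXKn n p.1 p.2) g.
  exact: smooth_adm (smooth_XXK n p.1 p.2).
rewrite pair_big /=.
have [[C C0 gC] E] := pot_lin L0 (index_enum _) (fun p => a p.1 p.2) adm.
rewrite -E potE -(iintZ _ C0 L0 gC); apply: iint_ge0 => v.
rewrite /integrand mulrCA mulr_ge0//.
have := Hs n (gmul c (ginv (P v)) g).
by rewrite pair_big.
Qed.

End limit.

(** * The p-Laplacian of a potential *)

Section flux.
Context {R : realType}.

Lemma is_derive_sumsq n (V : 'I_n -> R -> R) (dV : 'I_n -> R) :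
  (forall j, is_derive (0 : R) 1 (V j) (dV j)) ->
  is_derive (0 : R) 1 (fun s => \sum_j V j s ^+ 2) (2 * \sum_j V j 0 * dV j).
Proof.
elim: n V dV => [|n IH] V dV dVE.
  under eq_fun do rewrite big_ord0; rewrite big_ord0 mulr0.
  exact: is_derive_cst.
under eq_fun do rewrite big_ord_recl.
have h1 := IH _ _ (fun j => dVE (lift ord0 j)).
have h2 := is_deriveM (dVE ord0) (dVE ord0).
have := is_deriveD h2 h1.
have -> : (V ord0 * V ord0 + (fun s => \sum_j V (lift ord0 j) s ^+ 2))%R =
   (fun s => V ord0 s ^+ 2 + \sum_(i < n) V (lift ord0 i) s ^+ 2).
  by apply/funext => s; rewrite expr2.
rewrite big_ord_recl mulrDr.
have -> : V ord0 0 *: dV ord0 + V ord0 0 *: dV ord0 = 2 * (V ord0 0 * dV ord0).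
  by rewrite -[_ *: _]/(_ * _); ring.
by [].
Qed.

Lemma is_derive_flux n (V : 'I_n -> R -> R) (dV : 'I_n -> R) (i : 'I_n) (p : R) :
  2 < p -> (forall j, is_derive (0 : R) 1 (V j) (dV j)) ->
  let S s := \sum_j V j s ^+ 2 in
  is_derive (0 : R) 1 (fun s => Num.sqrt (S s) `^ (p - 2) * V i s)
    (if S 0 == 0 then 0 else
     S 0 `^ ((p - 4) / 2) * (S 0 * dV i + (p - 2) * (V i 0 * \sum_j V j 0 * dV j))).
Proof.
move=> p2 dVE S; have dS := is_derive_sumsq dVE; rewrite -/S in dS.
have S0 s : 0 <= S s by apply: sumr_ge0 => j _; exact: sqr_ge0.
pose q := (p - 2) / 2.
have q0 : 0 < q by rewrite divr_gt0// subr_gt0.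
have sE s : Num.sqrt (S s) `^ (p - 2) = S s `^ q.
  by rewrite -powR12_sqrt// -powRrM /q mulrC.
under eq_fun do rewrite sE.
case: ifPn => [/eqP Sz|Snz].
  have Vz : V i 0 = 0.
    apply/eqP; rewrite -sqrf_eq0; apply/eqP.
    by move: Sz => /psumr_eq0P; apply => // j _; exact: sqr_ge0.
  apply: is_derive_eps => e e0.
  have d1 : 0 < `|dV i| + 1 by rewrite ltr_wpDl.
  pose e1 := e / (`|dV i| + 1); have e10 : 0 < e1 by rewrite divr_gt0.
  have e20 : 0 < e1 `^ q^-1 by rewrite powR_gt0.
  have [r1 r10 h1] := is_derive_epsP (dVE i) ltr01.
  have /cvgrPdist_lt/(_ _ e20)[r2 /= r20 h2] := is_derive_cvg_self dS.
  exists (Num.min r1 r2); first by rewrite lt_min r10.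
  move=> h; rewrite lt_min => /andP[/h1 + hr2]; rewrite !add0r Vz mulr0 !subr0 mul1r.
  move=> hV; rewrite mulr0 subr0 normrM.
  have hV' : `|V i h| <= (`|dV i| + 1) * `|h|.
    have := ler_normD (V i h - h * dV i) (h * dV i); rewrite subrK normrM; lra.
  have hS : `|S h `^ q| <= e1.
    have := h2 h; rewrite /ball/= sub0r normrN Sz sub0r normrN => /(_ hr2).
    rewrite ger0_norm// ger0_norm ?powR_ge0// => hS.
    have -> : e1 = (e1 `^ q^-1) `^ q.
      by rewrite -powRrM mulVf ?gt_eqF// powRr1// ltW.
    by apply: ge0_ler_powR; rewrite ?nnegrE ?powR_ge0// ltW.
  apply: le_trans (ler_pM _ _ hS hV') _ => //.
  by rewrite mulrA divfK// gt_eqF.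
have Sp : 0 < S 0 by rewrite lt_neqAle eq_sym Snz S0.
have h1 := @is_derive1_comp _ (fun x => x `^ q) S 0 _ _ (is_derive1_powR q Sp) dS.
have := is_deriveM h1 (dVE i).
have -> : S 0 `^ q *: dV i + V i 0 *: (q * S 0 `^ (q - 1) * (2 * \sum_j V j 0 * dV j)) =
  S 0 `^ ((p - 4) / 2) * (S 0 * dV i + (p - 2) * (V i 0 * \sum_j V j 0 * dV j)).
  rewrite -![_ *: _]/(_ * _).
  have -> : S 0 `^ q = S 0 `^ ((p - 4) / 2) * S 0.
    rewrite -{3}(powRr1 (S0 0)) -powRDp//; congr (_ `^ _); rewrite /q; lra.
  have -> : q - 1 = (p - 4) / 2 by rewrite /q; lra.
  by rewrite /q; field.
by [].
Qed.

End flux.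

Section final.
Context {R : realType} {m k : nat} (c : 'I_k -> 'M[R]_m).
Hypothesis csk : bracket_skew c.
Hypothesis cH : Htype c.
Hypothesis k0 : (0 < k)%N.
Notation G := (G R m k).
Implicit Types (g h : G) (u : G -> R).
Variables (rho : G -> R).
Hypothesis rho_cont : continuous rho.
Hypothesis rho_ge0 : forall g, 0 <= rho g.
Hypothesis rho_supp : exists r : R, forall g, r < gauge g -> rho g = 0.
Variables (psi : R -> R) (kap b : R).
Hypothesis psiE : forall x : R, 0 < x -> is_derive x 1 psi (kap * x `^ (b - 1)).
Hypothesis psi_smooth : forall e, @smooth R m k e (K psi e).
Local Notation Q := ((m + 2 * k)%:R : R).
Hypothesis bQ : 0 < Q / 4 + b - 2^-1.
Let F : G -> R := pot c rho (fun h => psi (W h)).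

Lemma pot_regular :
  [/\ forall i, dX c i F (Xd c F i),
      forall i j, dX c i (Xd c F j) (Xd c (Xd c F j) i) &
      forall (sg : R) (a : 'I_m -> 'I_m -> R) g,
        (forall e h, 0 < e -> 0 <= sg * \sum_i \sum_j a i j * XXK c kap b e i j h) ->
        0 <= sg * \sum_i \sum_j a i j * Xd c (Xd c F j) i g].
Proof.
have [Cr [L [Cr0 L0 rho_le rsupp]]] := density_bounded rho_cont rho_supp.
have Q0 : 0 < Q by rewrite ltr0n addn_gt0 muln_gt0 k0 orbT.
pose t := Q / 4 + b - 2^-1; have t0 : 0 < t by exact: bQ.
(* Half of the slack [t] is spent on [d], which gives [d Q / 4 >= Q / 4 - t / 2], and the other half
   on [eta]. The maximum with [1/2] keeps [d] positive. *)
pose d := Num.max 2^-1 (1 - 2 * t / Q).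
have d0 : 0 < d by rewrite lt_max invr_gt0 ltr0n.
have d1 : d < 1.
  by rewrite gt_max; apply/andP; split; [lra|rewrite ltrBlDr ltrDl divr_gt0// mulr_gt0].
have dQ : Q / 4 - t / 2 <= d * Q / 4.
  have dm : 1 - 2 * t / Q <= d by rewrite /d le_max lexx orbT.
  have := ler_wpM2r (ltW Q0) dm; rewrite mulrBl divfK ?gt_eqF//.
  by move: (d * Q) => dq; lra.
pose eta := Num.min 1 (t / 2).
have eta0 : 0 < eta by rewrite lt_min ltr01 divr_gt0.
have eta1 : eta <= 1 by rewrite ge_min lexx.
have etat : eta <= t / 2 by rewrite ge_min lexx orbT.
have bge : 0 <= b - 2^-1 - eta + d * Q / 4 by rewrite /t in etat dQ; lra.
have P1 := pot_first csk cH k0 rho_cont Cr0 L0 rho_le rsupp d0 d1 erefl psiE psi_smooth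
  eta0 eta1 bge.
have P2 := pot_second csk cH k0 rho_cont Cr0 L0 rho_le rsupp d0 d1 erefl psiE psi_smooth
  eta0 eta1 bge.
have P3 := pot_sign csk cH k0 rho_cont rho_ge0 Cr0 L0 rho_le rsupp d0 d1 erefl psiE psi_smooth
  eta0 eta1 bge.
split; first by move=> i; exact: (P1 i).1.
- by move=> i j; exact: (P2 i j).1.
- by move=> sg a g H; apply: P3 => n h; apply: H; rewrite invr_gt0.
Qed.

Lemma quad_sum (N a : R) (v : 'rV[R]_m) (X : 'I_m -> 'I_m -> R) :
  \sum_i \sum_j (N * (j == i)%:R + a * (v 0 i * v 0 j)) * X i j =
  N * \sum_i X i i + a * \sum_i \sum_j v 0 i * v 0 j * X i j.
Proof.
rewrite !mulr_sumr -big_split; apply: eq_bigr => i _ /=.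
under eq_bigr => j _ do rewrite mulrDl.
rewrite big_split /= mulr_sumr; congr (_ + _); last first.
  by apply: eq_bigr => j _; rewrite !mulrA.
rewrite (bigD1 i)//= big1 ?addr0 ?eqxx ?mulr1// => j /negbTE ->.
by rewrite mulr0 mul0r.
Qed.

Lemma quad_sum_row (N a : R) (v : 'rV[R]_m) (X : 'I_m -> 'I_m -> R) :
  \sum_i (N * X i i + a * (v 0 i * \sum_j v 0 j * X i j)) =
  \sum_i \sum_j (N * (j == i)%:R + a * (v 0 i * v 0 j)) * X i j.
Proof.
rewrite quad_sum big_split /= -!mulr_sumr; congr (_ + _ * _).
by apply: eq_bigr => i _; rewrite mulr_sumr; apply: eq_bigr => j _; rewrite mulrA.
Qed.

Lemma sum_XXK e h (N a : R) (v : 'rV[R]_m) : 0 < e ->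
  N * \sum_i XXK c kap b e i i h + a * \sum_i \sum_j v 0 i * v 0 j * XXK c kap b e i j h =
  kap * (W h + e) `^ (b - 2) *
   ((b - 1) * (N * \sum_i XW c i h ^+ 2 + a * (\sum_i v 0 i * XW c i h) ^+ 2) +
    (W h + e) * (N * \sum_i XXW c i i h +
                 a * \sum_i \sum_j v 0 i * v 0 j * XXW c i j h)).
Proof.
move=> e0; have w0 := We_gt0 e0 h.
have E i j : XXK c kap b e i j h = kap * (W h + e) `^ (b - 2) * (b - 1) * (XW c i h * XW c j h) +
    kap * (W h + e) `^ (b - 2) * (W h + e) * XXW c i j h.
  rewrite /XXK (_ : (W h + e) `^ (b - 1) = (W h + e) `^ (b - 2) * (W h + e)); first by ring.
  by rewrite -{3}(powRr1 (ltW w0)) -powRDp//; congr (_ `^ _); lra.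
have -> : \sum_i XXK c kap b e i i h =
    kap * (W h + e) `^ (b - 2) * (b - 1) * (\sum_i XW c i h ^+ 2) +
    kap * (W h + e) `^ (b - 2) * (W h + e) * \sum_i XXW c i i h.
  by rewrite !mulr_sumr -big_split; apply: eq_bigr => i _; rewrite E expr2.
have -> : \sum_i \sum_j v 0 i * v 0 j * XXK c kap b e i j h =
    kap * (W h + e) `^ (b - 2) * (b - 1) * (\sum_i v 0 i * XW c i h) ^+ 2 +
    kap * (W h + e) `^ (b - 2) * (W h + e) * \sum_i \sum_j v 0 i * v 0 j * XXW c i j h.
  rewrite expr2 mulr_suml !mulr_sumr -big_split; apply: eq_bigr => i _ /=.
  rewrite !mulr_sumr -big_split; apply: eq_bigr => j _ /=.
  by rewrite E; ring.
by ring.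
Qed.

Lemma sym_sum (X : 'I_m -> 'I_m -> R) :
  2^-1 * (\sum_i \sum_j X i j + \sum_i \sum_j X j i) = \sum_i \sum_j X i j.
Proof.
by rewrite [X in _ + X]exchange_big /=; move: (\sum_i _) => S; field.
Qed.

(** The symmetrisation in the Hessian disappears against the symmetric coefficients
    [X_i u X_j u]. *)
Lemma LinfE u g : Linf c u g =
  \sum_i \sum_j (Xd c u i g * Xd c u j g) * Xd c (Xd c u j) i g.
Proof.
pose X i j := Xd c u i g * Xd c u j g * Xd c (Xd c u j) i g.
have -> : Linf c u g = 2^-1 * (\sum_i \sum_j X i j + \sum_i \sum_j X j i).
  rewrite -big_split mulr_sumr; apply: eq_bigr => i _ /=.
  rewrite -big_split mulr_sumr; apply: eq_bigr => j _ /=.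
  have A (x y z w : R) : 2^-1 * (z + w) * x * y = 2^-1 * (x * y * z + y * x * w) by ring.
  exact: A.
exact: sym_sum.
Qed.

Lemma Lp_sign (sg p : R) : 2 < p -> 0 <= sg * kap ->
  0 <= Q - p + 4 * b * (p - 1) -> 0 <= Q + p - 4 + 4 * b ->
  Lp_exists c p F /\ forall g, 0 <= sg * Lp c p F g.
Proof.
move=> p2 sk c1 c2; have [D1 D2 D3] := pot_regular.
pose v g : 'rV[R]_m := \row_i Xd c F i g.
have DF i g := @is_derive_flux _ m (fun j s => Xd c F j (gmul c g (Defs.expe i s)))
  (fun j => Xd c (Xd c F j) i g) i p p2 (fun j => D2 i j g).
have gE g : \sum_j Xd c F j g ^+ 2 = sqn R (v g).
  by apply: eq_bigr => j _; rewrite mxE.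
have XF i g : Xd c (flux c p F i) i g = if sqn R (v g) == 0 then 0 else
   sqn R (v g) `^ ((p - 4) / 2) * (sqn R (v g) * Xd c (Xd c F i) i g +
     (p - 2) * (v g 0 i * \sum_j v g 0 j * Xd c (Xd c F j) i g)).
  rewrite {1}/Xd derive1E; have [_ ->] := DF i g.
  rewrite expe0 gE mxE.
  by under [in RHS]eq_bigr => j _ do rewrite mxE.
split=> [i g|g].
  by split; [exact: dX_Xable (D1 i)|have [] := DF i g].
rewrite /Lp; have [vz|vn] := eqVneq (sqn R (v g)) 0.
  by rewrite big1 ?mulr0// => i _; rewrite XF vz eqxx.
under eq_bigr do rewrite XF (negbTE vn).
have -> : \sum_i (sqn R (v g) `^ ((p - 4) / 2) * (sqn R (v g) * Xd c (Xd c F i) i g +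
     (p - 2) * (v g 0 i * \sum_j v g 0 j * Xd c (Xd c F j) i g))) =
   sqn R (v g) `^ ((p - 4) / 2) * \sum_i \sum_j
     (sqn R (v g) * (j == i)%:R + (p - 2) * (v g 0 i * v g 0 j)) * Xd c (Xd c F j) i g.
  rewrite -mulr_sumr; congr (_ * _).
  exact: (quad_sum_row _ _ _ (fun i j => Xd c (Xd c F j) i g)).
(* The gradient [v g] is now a fixed vector, so the coefficients are constants and the sign is
   checked on the kernels. *)
rewrite mulrCA mulr_ge0 ?powR_ge0//; apply: D3 => e h e0.
rewrite quad_sum sum_XXK// mulrA mulr_ge0//.
  by rewrite mulrA mulr_ge0 ?powR_ge0.
by apply: hess_sum_ge0 => //; exact: ltW.
Qed.

Lemma Linf_sign : 0 <= kap -> 1 <= 4 * b -> inf_subharmonic c F.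
Proof.
move=> kp b4; have [D1 D2 D3] := pot_regular.
split=> [i j g|g].
  by split; [exact: dX_Xable (D1 i)|exact: dX_Xable (D2 i j)].
pose v : 'rV[R]_m := \row_i Xd c F i g.
have -> : Linf c F g = 1 * \sum_i \sum_j (v 0 i * v 0 j) * Xd c (Xd c F j) i g.
  rewrite mul1r LinfE; apply: eq_bigr => i _; apply: eq_bigr => j _.
  by rewrite ![v 0 _]mxE.
apply: D3 => e h e0; rewrite mul1r.
have := sum_XXK h 0 1 v e0; rewrite !mul0r !add0r !mul1r => ->.
rewrite mulr_ge0 ?mulr_ge0 ?powR_ge0//.
by apply: hess_vv_ge0 => //; exact: ltW.
Qed.

End final.

(** * Powers and logarithm of the gauge as kernels *)

Section gauge_kernel.
Context {R : realType} {m k : nat} (c : 'I_k -> 'M[R]_m).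
Hypothesis csk : bracket_skew c.
Notation G := (G R m k).
Implicit Types (g h : G).

Lemma gaugeE h : gauge h = W h `^ (4^-1).
Proof.
rewrite /gauge -/(W h) -!powR12_sqrt ?powR_ge0 ?W_ge0// -powRrM.
by congr (_ `^ _); field.
Qed.

(** The two arguments are inverse to each other, and inversion only changes the signs of the
    coordinates. *)
Lemma W_sym g h : W (gmul c (ginv g) h) = W (gmul c (ginv h) g).
Proof.
have sN n (x : 'rV[R]_n) : sqn R (- x) = sqn R x.
  by apply: eq_bigr => i _; rewrite rowNE sqrrN.
have bN (x y : 'rV[R]_m) r : bracket c (- x) y 0 r = - bracket c x y 0 r.
  by rewrite -scaleN1r !bracketE -sumrN; apply: eq_bigr => i _; rewrite czZ mulN1r mulNr.
have E1 : (gmul c (ginv g) h).1 = - (gmul c (ginv h) g).1.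
  by rewrite /= opprD opprK addrC.
have E2 : (gmul c (ginv g) h).2 = - (gmul c (ginv h) g).2.
  apply/rowP => r; rewrite /= !(rowDE, rowNE, rowZE) !bN.
  by rewrite [in LHS](bracketC csk g.1 h.1) rowNE; ring.
by rewrite /W E1 E2 !sN.
Qed.

Lemma FalphaE alpha rho : Falpha c alpha rho = pot c rho (fun h => W h `^ (- alpha / 4)).
Proof.
apply/funext => g; congr haar_int; apply/funext => g'.
by rewrite gaugeE W_sym -powRrM [4^-1 * _]mulrC.
Qed.

Lemma F0E rho : F0 c rho = pot c rho (fun h => 4^-1 * ln (W h)).
Proof.
apply/funext => g; congr haar_int; apply/funext => g'.
by rewrite gaugeE W_sym ln_powR.
Qed.

End gauge_kernel.

Lemma spans_dim_gt0 (R : realType) (m k : nat) (c : 'I_k -> 'M[R]_m) :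
  (0 < k)%N -> bracket_spans c -> (0 < m)%N.
Proof.
case: m c => [|//] c k0 sp.
have : delta_mx 0 (Ordinal k0) = 0 :> 'rV[R]_k.
  apply: sp => z z'; apply: big1 => r _.
  by rewrite bracketE big_ord0 mul0r.
by move=> /rowP/(_ (Ordinal k0)); rewrite !mxE !eqxx => /eqP; rewrite oner_eq0.
Qed.

Theorem theorem1p3 (R : realType) (m k : nat) (c : 'I_k -> 'M[R]_m)
    (rho : G R m k -> R) :
  (0 < k)%N ->
  bracket_skew c -> bracket_spans c -> Htype c ->
  continuous rho -> (forall g, 0 <= rho g) ->
  (exists r : R, forall g, r < gauge g -> rho g = 0) ->
  let Q : R := (m + 2 * k)%:R in
  (forall p alpha : R, 2 < p -> p < Q -> alpha < Q -> 0 < alpha ->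
     alpha <= (Q - p) / (p - 1) ->
     p_superharmonic c p (Falpha c alpha rho)) /\
  (forall p alpha : R, Q < p -> alpha < Q -> alpha != 0 ->
     (p - Q) / (p - 1) <= - alpha ->
     p_subharmonic c p (Falpha c alpha rho)) /\
  (forall alpha : R, alpha < Q -> alpha != 0 -> 1 <= - alpha ->
     inf_subharmonic c (Falpha c alpha rho)) /\
  p_subharmonic c Q (F0 c rho).
Proof.
move=> k0 csk csp cH rc r0 rs Q.
have m0 := spans_dim_gt0 k0 csp.
have Q3 : 3 <= Q.
  rewrite /Q (ler_nat R 3); move: k0 m0.
  by case: (m) (k) => [//|m'] [//|k'] _ _; rewrite mulnS addnA addnC !addnS.
have pE (b x : R) : 0 < x -> is_derive x 1 (fun y => y `^ b) (b * x `^ (b - 1)).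
  by move=> x0; exact: is_derive1_powR.
have pS b (e : R) : @smooth R m k e (K (fun y => y `^ b) e) by exact: smooth_powR.
split.
  move=> p alpha p2 pQ aQ a0; rewrite ler_pdivlMr ?subr_gt0; last lra.
  (* Then [alpha <= Q - p < Q - 2], which is [bQ]. Here [kap = - alpha / 4] is negative, hence the
     sign [-1] below. *)
  move=> apQ; have aa : alpha <= alpha * (p - 1) by rewrite ler_peMr//; lra.
  have bQ : 0 < Q / 4 + (- alpha / 4) - 2^-1 by lra.
  have [] := @Lp_sign _ _ _ c csk cH k0 rho rc r0 rs _ _ _ (pE (- alpha / 4))
    (pS (- alpha / 4)) bQ (-1) p p2 _ _ _; try by rewrite /Q in apQ aa pQ *; lra.
  rewrite FalphaE// => ex le; split=> // g.
  by have := le g; rewrite mulN1r oppr_ge0.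
split.
  move=> p alpha pQ aQ a0; rewrite ler_pdivrMr; last lra.
  move=> apQ.
  have a1 : alpha < 0.
    rewrite ltNge; apply/negP => a1.
    have : - alpha * (p - 1) <= 0 by rewrite mulNr oppr_le0 mulr_ge0//; lra.
    lra.
  have p2 : 2 < p by lra.
  have bQ : 0 < Q / 4 + (- alpha / 4) - 2^-1 by lra.
  have [] := @Lp_sign _ _ _ c csk cH k0 rho rc r0 rs _ _ _ (pE (- alpha / 4))
    (pS (- alpha / 4)) bQ 1 p p2 _ _ _; try by rewrite /Q in apQ Q3 pQ *; lra.
  rewrite FalphaE// => ex le; split=> // g.
  by have := le g; rewrite mul1r.
split.
  move=> alpha aQ a0 a1; rewrite FalphaE//.
  have bQ : 0 < Q / 4 + (- alpha / 4) - 2^-1 by lra.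
  by apply: (Linf_sign csk cH k0 rc r0 rs (pE (- alpha / 4)) (pS (- alpha / 4)) bQ); lra.
(* The logarithm is the case [b = 0], [kap = 1/4]; for [p = Q] the coefficient [Q - p + 4 b (p - 1)]
   is exactly [0]. *)
have lE (x : R) : 0 < x -> is_derive x 1 (fun y => 4^-1 * ln y) (4^-1 * x `^ (0 - 1)).
  move=> x0; have := is_deriveZ (4^-1) (is_derive1_ln x0).
  by rewrite sub0r powR_inv1// ltW.
have lS (e : R) : @smooth R m k e (K (fun y => 4^-1 * ln y) e).
  by apply: smoothM; [exact: smooth_cst|exact: smooth_ln].
have bQ : 0 < Q / 4 + 0 - 2^-1 by lra.
have p2 : 2 < Q by lra.
have [] := @Lp_sign _ _ _ c csk cH k0 rho rc r0 rs _ _ _ lE lS bQ 1 Q p2 _ _ _;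
  try by rewrite /Q in Q3 *; lra.
rewrite F0E// => ex le; split=> // g.
by have := le g; rewrite mul1r.
Qed.
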